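(* If $k\in\{1,3,5,8,10,13,15,16,18,20,23\}$ and $\ell$ is defined by $k+\ell=24$, then for every non-negative integer $n$, $$d_k(25n+\ell)\equiv 0\pmod 5.$$ Moreover, for $k\in\{5,8,10\}$ and $\ell$ defined by $k+\ell=24$, for every non-negative integer $n$, $$d_k(25n+\ell)\equiv 0\pmod{25}.$$
   Context: Notation: $(a;q)_{\infty}:=\prod_{j=0}^{\infty}(1-aq^j)$. For an integer $k\ge 0$ the integers $d_k(n)$, $n\ge 0$, are defined by $$\sum_{n=0}^{\infty}d_k(n)q^n=\frac{(q^2;q^2)_{\infty}^{k}}{(q;q)_{\infty}^{3k+1}},\qquad |q|<1.$$ *)

(* Defs.v *)
From mathcomp Require Import all_boot all_order all_algebra.
From mathcomp Require Import all_classical all_reals all_analysis.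
From mathcomp Require Import complex.
Import Order.TTheory GRing.Theory Num.Theory.
Import numFieldNormedType.Exports.

Set Implicit Arguments.
Unset Strict Implicit.
Unset Printing Implicit Defensive.

Local Open Scope classical_set_scope.
Local Open Scope ring_scope.

(* (a; q)_oo. [limn] is total, but over the complex numbers the partial
   products do converge whenever |q| < 1. *)
Definition qpochhammer (C : numFieldType) (a q : C) : C :=
  limn (fun n : nat => \prod_(0 <= j < n) (1 - a * q ^+ j)).

(* The generating function identity that defines (d_k(n))_n; it determines the
   sequence [dk] by uniqueness of power series coefficients. It is stated over
   an abstract field [C] because [R[i]] inherits its topology only through
   [numFieldType]; the intended instance is [C := R[i]]. *)
Definition is_dk (C : numFieldType) (k : nat) (dk : nat -> int) : Prop :=
  forall q : C, `|q| < 1 ->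
    series (fun n : nat => (dk n)%:~R * q ^+ n) @ \oo -->
    qpochhammer (q ^+ 2) (q ^+ 2) ^+ k / qpochhammer q q ^+ (3 * k + 1).

(* Main.v *)
From HB Require Import structures.
Require Import Defs.
From mathcomp Require Import all_boot all_order all_algebra.
From mathcomp Require Import all_classical all_reals all_analysis.
From mathcomp Require Import complex finfield.
From mathcomp Require Import ring lra zify.
Import Order.TTheory GRing.Theory Num.Theory.
Import numFieldNormedType.Exports.

(** Write [E(q) = (q; q)_oo] and [D_k(q) = sum_n d_k(n) q^n], so that
    [D_k(q) E(q)^(3k+1) = E(q^2)^k]. This analytic identity, used for small real
    [q], forces the formal one (is_dk_fps): truncating everything at order [N]
    leaves an integer polynomial that is [O(q^(N+1))] at [0]. From then on the proof
    is an algebraic one, with power series over the integers and over the field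
    with [5] elements.

    Each series is split into its five sections [U_c f = sum_n f(5n + c) q^n]; the
    claims are about [U_i U_j D_k] where [l = 5 i + j]. By the pentagonal number
    theorem, [E(q) = A(q^5) - q C(q^5) - q^2 B(q^5)] with [C(q) = E(q^5)]. Gauss's
    identity [E(q)^2 = E(q^2) theta4(q)], whose right factor has no exponent
    congruent to [2] or [3] modulo [5] (and whose exponents divisible by [5] form
    [theta4(q^25)]), gives [A B = C^2]. Hence, for instance, [U_4 (E^4) = -5 C^4],
    [U_3 (E^3) = 5 C^3] and [U_3 (E^8) = -125 q C^8]. Both theta identities follow
    from finite telescoping sums in the manner of Shanks.

    Modulo [5] one has [f(q)^5 = f(q^5)]. After multiplication by a suitable power
    of [E], the denominator of [D_k] is a series in [q^5] (or in [q^25], for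
    [k = 1] and [k = 16]) and the numerator is, up to factors in [q^5], [E(q)^4] if
    [5 | k], [E(q^2)^3] if [k = 3] modulo [5], or [E(q) E(q^2)] if [k = 1] or
    [k = 16]; in the last case [U_3] turns it into [E(q^5) E(q^10)], and the two
    other cases apply. The identities above conclude.

    Modulo [25] the denominator can be made a series in [q^5] in the same way, and
    [k = 8] follows from the formula for [U_3 (E^8)]. For [k = 5] and [k = 10],
    [U_4 D_k = 5 G] (sect4_descent), and [G] has to be known modulo [5]. Writing
    [E^5 = P(q^5) + 5 Y], it is a combination of [U_4 (Y(q) E(q)^4)] and
    [U_4 (Y(q^2) E(q)^4)]. The other sections of Gauss's identity relate the
    dissections of [E(q)] and [E(q^2)]; in terms of [r = B/C] they amount to
    Ramanujan's relation between the Rogers-Ramanujan continued fraction at [q]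
    and at [q^2], so that, apart from powers of [r], [C(q)] and [C(q^2)], everything
    is a rational function of one parameter (section LevelTen). From these functions
    one reads off, modulo [5], that [U_4 (Y(q^2) E(q)^4)] equals
    [E(q)^4 E(q^2)^9 - 2 E(q^5)^4 E(q^2)] and that [U_2 (E(q)^3 E(q^2)^2)] equals
    [3 E(q)^7 E(q^2)^2]. It follows that [G = E(q^2)^9] modulo [5] for [k = 5],
    with [U_3 (E(q^2)^4) = 0], and a cancellation between two terms does the same
    for [k = 10]. *)

Set Implicit Arguments.
Unset Strict Implicit.
Unset Printing Implicit Defensive.

Local Open Scope ring_scope.

(** * Formal power series *)

(** Power series, given by their coefficients; the record keeps the Cauchy product
    apart from the pointwise product of functions. *)
Record fps (R : Type) := Fps { coefs :> nat -> R }.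

HB.instance Definition _ (R : Type) := gen_eqMixin (fps R).
HB.instance Definition _ (R : Type) := gen_choiceMixin (fps R).

Lemma fpsP (R : Type) (f g : fps R) : (forall n, f n = g n) -> f = g.
Proof. by case: f g => [f] [g] /= fg; congr Fps; apply/funext. Qed.

Section FpsZmod.
Variable R : zmodType.

Definition fps_add (f g : fps R) := Fps (fun n => f n + g n).
Definition fps_opp (f : fps R) := Fps (fun n => - f n).

Let addA : associative fps_add.
Proof. by move=> f g h; apply: fpsP => n /=; rewrite addrA. Qed.
Let addC : commutative fps_add.
Proof. by move=> f g; apply: fpsP => n /=; rewrite addrC. Qed.
Let add0 : left_id (Fps (fun=> 0)) fps_add.
Proof. by move=> f; apply: fpsP => n /=; rewrite add0r. Qed.
Let addN : left_inverse (Fps (fun=> 0)) fps_opp fps_add.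
Proof. by move=> f; apply: fpsP => n /=; rewrite addNr. Qed.

HB.instance Definition _ := GRing.isZmodule.Build (fps R) addA addC add0 addN.

Lemma fps0E n : (0 : fps R) n = 0. Proof. by []. Qed.
Lemma fpsDE (f g : fps R) n : (f + g) n = f n + g n. Proof. by []. Qed.
Lemma fpsNE (f : fps R) n : (- f) n = - f n. Proof. by []. Qed.
Lemma fpsBE (f g : fps R) n : (f - g) n = f n - g n. Proof. by []. Qed.
Lemma fpsMnE (f : fps R) m n : (f *+ m) n = f n *+ m.
Proof. by elim: m => // m IH; rewrite !mulrS fpsDE IH. Qed.

End FpsZmod.

Section FpsRing.
Variable R : comNzRingType.

(** The truncation [f mod q^N], as a polynomial. *)
Definition fps_trunc N (f : fps R) : {poly R} := \poly_(i < N) f i.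

Definition fps_of_poly (p : {poly R}) : fps R := Fps (fun n => p`_n).

Definition fps_mul (f g : fps R) := Fps (fun n => \sum_(i < n.+1) f i * g (n - i)%N).

Lemma coef_trunc N (f : fps R) n : (n < N)%N -> (fps_trunc N f)`_n = f n.
Proof. by move=> nN; rewrite coef_poly nN. Qed.

Let mul_coef (f g : fps R) (p r : {poly R}) n :
    (forall i, (i <= n)%N -> f i = p`_i) -> (forall i, (i <= n)%N -> g i = r`_i) ->
  fps_mul f g n = (p * r)`_n.
Proof.
move=> fp gr; rewrite coefM; apply: eq_bigr => i _.
by rewrite fp ?gr ?leq_subr // -ltnS.
Qed.

Let trunc_coef (f : fps R) n : forall i, (i <= n)%N -> f i = (fps_trunc n.+1 f)`_i.
Proof. by move=> i le_in; rewrite coef_trunc. Qed.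

Let mul_trunc (f g : fps R) n :
  forall i, (i <= n)%N -> fps_mul f g i = (fps_trunc n.+1 f * fps_trunc n.+1 g)`_i.
Proof.
move=> i le_in; apply: mul_coef => j le_ji; apply: trunc_coef; exact: leq_trans le_ji le_in.
Qed.

Let mulA : associative fps_mul.
Proof.
move=> f g h; apply: fpsP => n.
rewrite (mul_coef (@trunc_coef f n) (@mul_trunc g h n)).
by rewrite (mul_coef (@mul_trunc f g n) (@trunc_coef h n)) mulrA.
Qed.
Let mulC : commutative fps_mul.
Proof. by move=> f g; apply: fpsP => n; rewrite !(mul_trunc _ _ (leqnn n)) mulrC. Qed.
Let mul1 : left_id (fps_of_poly 1) fps_mul.
Proof.
move=> f; apply: fpsP => n.
rewrite (@mul_coef (fps_of_poly 1) f 1 (fps_trunc n.+1 f) n) //; last exact: trunc_coef.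
by rewrite mul1r coef_trunc.
Qed.
Let mulDl : left_distributive fps_mul +%R.
Proof.
move=> f g h; apply: fpsP => n /=; rewrite -big_split /=.
by apply: eq_bigr => i _; rewrite mulrDl.
Qed.
Let one_neq0 : fps_of_poly 1 != 0.
Proof.
apply/eqP => /(congr1 (fun f : fps R => f 0%N)) /=; rewrite coefC eqxx.
by move/eqP; rewrite oner_eq0.
Qed.

HB.instance Definition _ :=
  GRing.Zmodule_isComNzRing.Build (fps R) mulA mulC mul1 mulDl one_neq0.

Lemma fpsME (f g : fps R) n : (f * g) n = \sum_(i < n.+1) f i * g (n - i)%N.
Proof. by []. Qed.

(** The coefficient of order [n] of a product only depends on the factors up to
    order [n], and may be computed with polynomials. *)
Lemma fpsM_coef (f g : fps R) (p r : {poly R}) n :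
    (forall i, (i <= n)%N -> f i = p`_i) -> (forall i, (i <= n)%N -> g i = r`_i) ->
  (f * g) n = (p * r)`_n.
Proof. exact: mul_coef. Qed.

Lemma fpsX_coef (f : fps R) (p : {poly R}) n k :
  (forall i, (i <= n)%N -> f i = p`_i) -> (f ^+ k) n = (p ^+ k)`_n.
Proof.
elim: k n => [|k IH] n fp; first by rewrite !expr0.
rewrite !exprS; apply: fpsM_coef => // i le_in; apply: IH => j le_ji.
by apply: fp; apply: leq_trans le_in.
Qed.

Lemma fpsM0 (f g : fps R) : (f * g) 0%N = f 0%N * g 0%N.
Proof. by rewrite fpsME big_ord_recl big_ord0 addr0. Qed.

Lemma fps10 : (1 : fps R) 0%N = 1.
Proof. by rewrite /= coefC. Qed.

Lemma fps_nat0 n : (n%:R : fps R) 0%N = n%:R.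
Proof. by rewrite fpsMnE fps10. Qed.

Lemma fpsX0 (f : fps R) n : (f ^+ n) 0%N = f 0%N ^+ n.
Proof. by elim: n => [|n IH]; rewrite ?fps10 // !exprS fpsM0 IH. Qed.

Fact fps_of_poly_zmod : zmod_morphism fps_of_poly.
Proof. by move=> p r; apply: fpsP => n /=; rewrite coefB. Qed.
Fact fps_of_poly_monoid : monoid_morphism fps_of_poly.
Proof.
split=> [|p r]; apply: fpsP => n; first by [].
by apply: esym; apply: fpsM_coef.
Qed.
HB.instance Definition _ :=
  GRing.isZmodMorphism.Build {poly R} (fps R) fps_of_poly fps_of_poly_zmod.
HB.instance Definition _ :=
  GRing.isMonoidMorphism.Build {poly R} (fps R) fps_of_poly fps_of_poly_monoid.

(** The constant term. *)
Definition fps_const (f : fps R) := f 0%N.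

Fact fps_const_zmod : zmod_morphism fps_const. Proof. by []. Qed.
Fact fps_const_monoid : monoid_morphism fps_const.
Proof. by split; [exact: fps10 | exact: fpsM0]. Qed.
HB.instance Definition _ :=
  GRing.isZmodMorphism.Build (fps R) R fps_const fps_const_zmod.
HB.instance Definition _ :=
  GRing.isMonoidMorphism.Build (fps R) R fps_const fps_const_monoid.

(** The variable. *)
Definition fpsq : fps R := fps_of_poly 'X.

Lemma fpsqM (f : fps R) k n : (fpsq ^+ k * f) n = if (n < k)%N then 0 else f (n - k)%N.
Proof.
rewrite -rmorphXn (@fpsM_coef _ _ 'X^k (fps_trunc n.+1 f) n) //; last first.
  by move=> i le_in; rewrite coef_trunc.
by rewrite coefXnM; case: ltnP => // _; rewrite coef_trunc // ltnS leq_subr.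
Qed.

End FpsRing.

Section FpsDomain.
Variable R : idomainType.

(** Units are defined classically: only the integral domain structure matters
    below, as a step to the field of fractions. *)
Definition fps_unit : {pred fps R} := fun f => `[< exists g, g * f = 1 >].
Definition fps_inv (f : fps R) : fps R :=
  if pselect (exists g, g * f = 1) is left fU then projT1 (cid fU) else f.

Let mulV : {in fps_unit, left_inverse 1 fps_inv *%R}.
Proof. by move=> f /asboolP fU; rewrite /fps_inv; case: pselect => // ?; case: cid. Qed.
Let unitPl (f g : fps R) : g * f = 1 -> f \in fps_unit.
Proof. by move=> gf; apply/asboolP; exists g. Qed.
Let invr_out : {in [predC fps_unit], fps_inv =1 id}.
Proof. by move=> f /asboolP fU; rewrite /fps_inv; case: pselect. Qed.

HB.instance Definition _ :=
  GRing.ComNzRing_hasMulInverse.Build (fps R) mulV unitPl invr_out.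

Lemma fps_order (f : fps R) : f != 0 ->
  exists2 m, f m != 0 & forall i, (i < m)%N -> f i = 0.
Proof.
move=> f0; have exf : exists n, f n != 0.
  apply: contrapT => nf; case/eqP: f0; apply: fpsP => n.
  by apply/eqP; apply: contrapT => /negP fn; apply: nf; exists n.
exists (ex_minn exf); case: ex_minnP => // m fm min_m i lt_im.
by apply/eqP; apply: contraTT lt_im => /min_m; rewrite -leqNgt.
Qed.

Let mulf_eq0 (f g : fps R) : f * g = 0 -> (f == 0) || (g == 0).
Proof.
move=> fg; apply: contraT; rewrite negb_or => /andP[/fps_order[m fm mf] /fps_order[n gn ng]].
have /eqP := congr1 (fun h : fps R => h (m + n)%N) fg.
rewrite fpsME fps0E (bigD1 (inord m : 'I_(m + n).+1)) //= big1 ?addr0.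
  by rewrite inordK ?ltnS ?leq_addr // addKn mulf_eq0 (negbTE fm) (negbTE gn).
move=> i; rewrite -val_eqE /= inordK ?ltnS ?leq_addr // => neq_im.
have /orP[lt_im|lt_mi] : (i < m)%N || (m < i)%N by rewrite -neq_ltn.
  by rewrite mf ?mul0r.
by rewrite ng ?mulr0 //; have := ltn_ord i; lia.
Qed.

HB.instance Definition _ := GRing.ComUnitRing_isIntegral.Build (fps R) mulf_eq0.

End FpsDomain.

Section Dilation.
Variable R : comNzRingType.

(** [fps_dil s f] is [f(q^s)] (for [s = 0], the constant term of [f]). *)
Definition fps_dil s (f : fps R) : fps R :=
  Fps (fun n => if (s %| n)%N then f (n %/ s)%N else 0).

Lemma fps_dilE s (f : fps R) n :
  fps_dil s f n = if (s %| n)%N then f (n %/ s)%N else 0.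
Proof. by []. Qed.

Fact fps_dil_zmod s : zmod_morphism (fps_dil s).
Proof. by move=> f g; apply: fpsP => n /=; case: ifP => // _; rewrite subr0. Qed.

Lemma fps_dil_poly s (p : {poly R}) : (0 < s)%N ->
  fps_dil s (fps_of_poly p) = fps_of_poly (p \Po 'X^s).
Proof. by move=> s0; apply: fpsP => n /=; rewrite coef_comp_poly_Xn. Qed.

Fact fps_dil_monoid s : monoid_morphism (fps_dil s).
Proof.
split.
  apply: fpsP => n /=; rewrite !coefC; case: n => [|n]; first by rewrite dvdn0 div0n.
  case: ifP => // s_n; rewrite -leqn0 leqNgt divn_gt0 ?(dvdn_gt0 _ s_n) //.
  by rewrite dvdn_leq.
move=> f g; apply: fpsP => n; case: (posnP s) => [->|s0].
  rewrite fps_dilE; case: n => [|n]; first by rewrite dvd0n eqxx div0n !fpsM0.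
  rewrite dvd0n [RHS]fpsME big1 // => i _; rewrite !fps_dilE !dvd0n.
  have [->|] := eqVneq (i : nat) 0%N; first by rewrite subn0 /= mulr0.
  by rewrite mul0r.
have dilT (h : fps R) i : (i <= n)%N ->
    fps_dil s h i = (fps_trunc n.+1 h \Po 'X^s)`_i.
  move=> le_in; rewrite coef_comp_poly_Xn // fps_dilE; case: ifP => // _.
  by rewrite coef_trunc // ltnS (leq_trans (leq_div _ _) le_in).
rewrite (fpsM_coef (dilT f) (dilT g)) -comp_polyM coef_comp_poly_Xn // fps_dilE.
case: ifP => // _; apply: fpsM_coef => i le_in; rewrite coef_trunc // ltnS.
  by apply: leq_trans le_in (leq_div _ _).
by apply: leq_trans le_in (leq_div _ _).
Qed.

HB.instance Definition _ s :=
  GRing.isZmodMorphism.Build (fps R) (fps R) (fps_dil s) (fps_dil_zmod s).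
HB.instance Definition _ s :=
  GRing.isMonoidMorphism.Build (fps R) (fps R) (fps_dil s) (fps_dil_monoid s).

Lemma fps_dilq s : (0 < s)%N -> fps_dil s (fpsq R) = fpsq R ^+ s.
Proof. by move=> s0; rewrite fps_dil_poly // comp_polyX rmorphXn. Qed.

Lemma fps_dilC s t (f : fps R) : (0 < s)%N -> (0 < t)%N ->
  fps_dil s (fps_dil t f) = fps_dil t (fps_dil s f).
Proof.
suff dilM s' t' : (0 < s')%N -> (0 < t')%N ->
    fps_dil s' (fps_dil t' f) = fps_dil (s' * t') f.
  by move=> *; rewrite !dilM // mulnC.
move=> s0 t0; apply: fpsP => n; rewrite !fps_dilE.
have [/dvdnP[k ->]|ns] := boolP (s' %| n)%N.
  rewrite mulnK // [(k * s')%N]mulnC dvdn_pmul2l // divnMl //.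
by case: ifP => // /(dvdn_trans (dvdn_mulr _ (dvdnn _))); rewrite (negPf ns).
Qed.

(** The [c]-th section modulo [5]: [fps_sect c f] is the sum of the
    [f (5 n + c) q^n]. *)
Definition fps_sect c (f : fps R) : fps R := Fps (fun n => f (5 * n + c)%N).

Lemma fps_sectE c (f : fps R) n : fps_sect c f n = f (5 * n + c)%N.
Proof. by []. Qed.

Fact fps_sect_zmod c : zmod_morphism (fps_sect c).
Proof. by move=> f g; apply: fpsP => n. Qed.
HB.instance Definition _ c :=
  GRing.isZmodMorphism.Build (fps R) (fps R) (fps_sect c) (fps_sect_zmod c).

Local Notation V := (fps_dil 5).
Local Notation U := fps_sect.
Local Notation q := (fpsq R).

Lemma sect_qV c k (f : fps R) : (c < 5)%N -> (k < 5)%N ->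
  U c (q ^+ k * V f) = if c == k then f else 0.
Proof.
move=> c5 k5; apply: fpsP => n; rewrite fps_sectE fpsqM fps_dilE.
case: eqP => [<-|ck].
  by rewrite ltnNge leq_addl /= addnK dvdn_mulr // mulKn.
rewrite fps0E; case: ltnP => // le_k; case: ifP => // /dvdnP[m]; lia.
Qed.

(** The decomposition into sections is unique. *)
Lemma sect_sum c (f0 f1 f2 f3 f4 : fps R) : (c < 5)%N ->
  U c (V f0 + q * V f1 + q ^+ 2 * V f2 + q ^+ 3 * V f3 + q ^+ 4 * V f4)
  = [:: f0; f1; f2; f3; f4]`_c.
Proof.
move=> c5; rewrite -[V f0]mul1r -(expr0 q) -[q in q * V f1]expr1.
rewrite !raddfD /= !sect_qV //.
by move: c c5 => [|[|[|[|[|c]]]]] //= _; rewrite ?addr0 ?add0r.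
Qed.

Lemma sect_dec (f : fps R) :
  f = V (U 0 f) + q * V (U 1 f) + q ^+ 2 * V (U 2 f) + q ^+ 3 * V (U 3 f)
      + q ^+ 4 * V (U 4 f).
Proof.
set g := RHS; apply: fpsP => n.
have -> : n = (5 * (n %/ 5) + n %% 5)%N by rewrite mulnC -divn_eq.
rewrite -!fps_sectE /g sect_sum ?ltn_mod //.
by have := ltn_pmod n (isT : 0 < 5)%N; move: (n %% 5)%N => [|[|[|[|[|c]]]]].
Qed.

Lemma sectVM c (f g : fps R) : (c < 5)%N -> U c (V f * g) = f * U c g.
Proof.
move=> c5; rewrite {1}[g]sect_dec.
have -> : forall g0 g1 g2 g3 g4, V f * (V g0 + q * V g1 + q ^+ 2 * V g2 + q ^+ 3 * V g3
   + q ^+ 4 * V g4) = V (f * g0) + q * V (f * g1) + q ^+ 2 * V (f * g2)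
   + q ^+ 3 * V (f * g3) + q ^+ 4 * V (f * g4).
  by move=> *; rewrite !rmorphM /=; ring.
by rewrite sect_sum //; move: c c5 => [|[|[|[|[|c]]]]].
Qed.

(** Products of sections; the factor [q] appears when the residues add up to [5]
    or more. *)
Lemma sectM (f g : fps R) :
  [/\ U 0 (f * g) = U 0 f * U 0 g
        + q * (U 1 f * U 4 g + U 2 f * U 3 g + U 3 f * U 2 g + U 4 f * U 1 g),
      U 1 (f * g) = U 0 f * U 1 g + U 1 f * U 0 g
        + q * (U 2 f * U 4 g + U 3 f * U 3 g + U 4 f * U 2 g),
      U 2 (f * g) = U 0 f * U 2 g + U 1 f * U 1 g + U 2 f * U 0 g
        + q * (U 3 f * U 4 g + U 4 f * U 3 g),
      U 3 (f * g) = U 0 f * U 3 g + U 1 f * U 2 g + U 2 f * U 1 g + U 3 f * U 0 g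
        + q * (U 4 f * U 4 g) &
      U 4 (f * g) = U 0 f * U 4 g + U 1 f * U 3 g + U 2 f * U 2 g + U 3 f * U 1 g
        + U 4 f * U 0 g].
Proof.
have -> : f * g =
    V (U 0 f * U 0 g
       + q * (U 1 f * U 4 g + U 2 f * U 3 g + U 3 f * U 2 g + U 4 f * U 1 g))
    + q * V (U 0 f * U 1 g + U 1 f * U 0 g
       + q * (U 2 f * U 4 g + U 3 f * U 3 g + U 4 f * U 2 g))
    + q ^+ 2 * V (U 0 f * U 2 g + U 1 f * U 1 g + U 2 f * U 0 g
       + q * (U 3 f * U 4 g + U 4 f * U 3 g))
    + q ^+ 3 * V (U 0 f * U 3 g + U 1 f * U 2 g + U 2 f * U 1 g + U 3 f * U 0 g
       + q * (U 4 f * U 4 g))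
    + q ^+ 4 * V (U 0 f * U 4 g + U 1 f * U 3 g + U 2 f * U 2 g + U 3 f * U 1 g
       + U 4 f * U 0 g).
  rewrite {1}[f]sect_dec {1}[g]sect_dec !rmorphD !rmorphM /= !rmorphD !rmorphM /=.
  by rewrite fps_dilq //; ring.
by split; rewrite sect_sum.
Qed.

(** Sections of [f(q^2)]: for instance [5 n + 1 = 2 (5 m + 3)] means [n = 2 m + 1],
    whence the factor [q] in the second equation. *)
Lemma sect_dil2 (f : fps R) :
  [/\ U 0 (fps_dil 2 f) = fps_dil 2 (U 0 f),
      U 1 (fps_dil 2 f) = q * fps_dil 2 (U 3 f),
      U 2 (fps_dil 2 f) = fps_dil 2 (U 1 f),
      U 3 (fps_dil 2 f) = q * fps_dil 2 (U 4 f) &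
      U 4 (fps_dil 2 f) = fps_dil 2 (U 2 f)].
Proof.
have -> : fps_dil 2 f = V (fps_dil 2 (U 0 f)) + q * V (q * fps_dil 2 (U 3 f))
    + q ^+ 2 * V (fps_dil 2 (U 1 f)) + q ^+ 3 * V (q * fps_dil 2 (U 4 f))
    + q ^+ 4 * V (fps_dil 2 (U 2 f)).
  rewrite {1}[f]sect_dec !rmorphD !rmorphM /= !fps_dilq //.
  by rewrite ![fps_dil 2 (V _)]fps_dilC //; ring.
by split; rewrite sect_sum.
Qed.

End Dilation.

Section MapFps.
Variables (R S : comNzRingType) (h : {rmorphism R -> S}).

(** Coefficientwise image. *)
Definition map_fps (f : fps R) : fps S := Fps (fun n => h (f n)).

Fact map_fps_zmod : zmod_morphism map_fps.
Proof. by move=> f g; apply: fpsP => n /=; rewrite rmorphB. Qed.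
Fact map_fps_monoid : monoid_morphism map_fps.
Proof.
split; first by apply: fpsP => n /=; rewrite !coefC; case: ifP; rewrite ?rmorph1 ?rmorph0.
by move=> f g; apply: fpsP => n /=; rewrite rmorph_sum; apply: eq_bigr => i _; rewrite rmorphM.
Qed.
HB.instance Definition _ :=
  GRing.isZmodMorphism.Build (fps R) (fps S) map_fps map_fps_zmod.
HB.instance Definition _ :=
  GRing.isMonoidMorphism.Build (fps R) (fps S) map_fps map_fps_monoid.

Lemma map_fps_dil s f : map_fps (fps_dil s f) = fps_dil s (map_fps f).
Proof. by apply: fpsP => n /=; case: ifP; rewrite ?rmorph0. Qed.

Lemma map_fps_sect c f : map_fps (fps_sect c f) = fps_sect c (map_fps f).
Proof. by []. Qed.

Lemma map_fpsq : map_fps (fpsq R) = fpsq S.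
Proof. by apply: fpsP => n /=; rewrite !coefX; case: eqP; rewrite ?rmorph1 ?rmorph0. Qed.

End MapFps.

(** * Finite forms of the theta identities *)

Section Shanks.
Variable R : comNzRingType.
Variable x : R.

(** The product of the [1 - x^j] for [k < j <= n]. *)
Definition euler_range k n : R := \prod_(k.+1 <= j < n.+1) (1 - x ^+ j).

Let sumSr m n (F : nat -> R) : (m <= n)%N ->
  \sum_(m <= k < n.+1) F k = \sum_(m <= k < n) F k + F n.
Proof. exact: big_nat_recr. Qed.

Let prodSr m n (F : nat -> R) : (m <= n)%N ->
  \prod_(m <= k < n.+1) F k = \prod_(m <= k < n) F k * F n.
Proof. exact: big_nat_recr. Qed.

Lemma euler_rangeSr k n : (k <= n)%N ->
  euler_range k n.+1 = euler_range k n * (1 - x ^+ n.+1).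
Proof. by move=> le_kn; rewrite /euler_range big_nat_recr. Qed.

Lemma euler_rangeSl k n : (k < n)%N ->
  euler_range k n = (1 - x ^+ k.+1) * euler_range k.+1 n.
Proof. by move=> lt_kn; rewrite /euler_range big_ltn. Qed.

Lemma euler_range_nn n : euler_range n n = 1.
Proof. by rewrite /euler_range big_geq. Qed.

(** The [k]-th term of the sum by which Shanks truncates the pentagonal series. *)
Definition shanks_term n k :=
  (-1) ^+ k * euler_range k n * x ^+ (k * n + (k * k.+1)./2).

Lemma half_tri k : (k.+1 * k.+2)./2 = ((k * k.+1)./2 + k.+1)%N.
Proof.
by rewrite (_ : k.+1 * k.+2 = k.+1.*2 + k * k.+1)%N ?halfD ?doubleK ?odd_double; lia.
Qed.

Lemma tri_double k : (2 * (k * k.+1)./2 = k * k.+1)%N.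
Proof. by rewrite mul2n even_halfK // oddM /= andbN. Qed.

Lemma pent_double k :
  (2 * (k * (3 * k - 1))./2 = k * (3 * k - 1))%N
  /\ (2 * (k * (3 * k + 1))./2 = k * (3 * k + 1))%N.
Proof.
split; rewrite mul2n even_halfK //; last by rewrite oddM oddD oddM /=; case: odd.
case: k => [|k] //; rewrite (_ : 3 * k.+1 - 1 = 3 * k + 2)%N; last by lia.
by rewrite oddM oddD oddM /=; case: odd.
Qed.

(** Shanks' finite form of the pentagonal number theorem. *)
Lemma shanks_pentagonal n :
  \sum_(0 <= k < n.+1) shanks_term n k
  = 1 + \sum_(1 <= k < n.+1)
      (-1) ^+ k * (x ^+ (k * (3 * k - 1))./2 + x ^+ (k * (3 * k + 1))./2).
Proof.
elim: n => [|n IH].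
  by rewrite big_nat1 [in RHS]big_geq // /shanks_term /euler_range big_geq // !mul1r addr0.
rewrite [in RHS]sumSr // addrA -{}IH [LHS]sumSr //.
have tS k : (k <= n)%N ->
    shanks_term n.+1 k = (1 - x ^+ n.+1) * x ^+ k * shanks_term n k.
  move=> le_kn; rewrite /shanks_term euler_rangeSr //.
  by rewrite (_ : k * n.+1 + _ = k + (k * n + (k * k.+1)./2))%N ?exprD; [ring | lia].
have tk k : (k < n)%N ->
    shanks_term n k * x ^+ (n.+1 + k) = - shanks_term n k.+1 * (1 - x ^+ k.+1).
  move=> lt_kn; rewrite /shanks_term (euler_rangeSl lt_kn) half_tri [(-1) ^+ k.+1]exprS.
  rewrite (_ : k.+1 * n + _ = (k * n + (k * k.+1)./2) + (n.+1 + k))%N; last by lia.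
  by rewrite !exprD; ring.
(* The difference of two consecutive sums telescopes. *)
have tele j : (j <= n)%N -> \sum_(0 <= k < j.+1) shanks_term n.+1 k
    = \sum_(0 <= k < j.+1) shanks_term n k - shanks_term n j * x ^+ (n.+1 + j).
  elim: j => [|j IH] le_jn; first by rewrite !big_nat1 tS // expr0 addn0 mulr1; ring.
  rewrite big_nat_recr //= IH 1?ltnW // [in RHS]big_nat_recr //= tS // tk //.
  by rewrite exprD; ring.
rewrite tele // -!addrA; congr (_ + _).
rewrite /shanks_term !euler_range_nn.
have [e1 e2] := pent_double n.+1; have e3 := tri_double n.
rewrite (_ : (n.+1 * (3 * n.+1 - 1))./2 = (n * n + (n * n.+1)./2) + (n.+1 + n))%N; last by nia.
rewrite (_ : (n.+1 * (3 * n.+1 + 1))./2 = n.+1 * n.+1 + (n.+1 * n.+2)./2)%N; last first.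
  by have e4 := tri_double n.+1; nia.
by rewrite !exprD [(-1) ^+ n.+1]exprS; ring.
Qed.

(** The [k]-th term of the corresponding sum for squares. *)
Definition gauss_term n k :=
  (-1) ^+ k * x ^+ (k * n.+1) * euler_range k n * \prod_(0 <= j < k) (1 + x ^+ j).

(** The analogous finite form of Gauss's identity for the alternating theta
    series of squares. *)
Lemma shanks_gauss n :
  \sum_(0 <= k < n.+1) gauss_term n k
  = \prod_(1 <= j < n.+1) (1 + x ^+ j)
    * (1 + \sum_(1 <= k < n.+1) 2 * (-1) ^+ k * x ^+ (k * k)).
Proof.
elim: n => [|n IH].
  by rewrite big_nat1 !big_geq // /gauss_term !big_geq // /euler_range big_geq // !mul1r addr0.
rewrite [LHS]sumSr // [in RHS]prodSr // [in RHS]sumSr //.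
set pi := \prod_(1 <= j < n.+1) _ in IH *; set S := \sum_(1 <= k < n.+1) _ in IH *.
have -> : pi * (1 + x ^+ n.+1) * (1 + (S + 2 * (-1) ^+ n.+1 * x ^+ (n.+1 * n.+1)))
  = (1 + x ^+ n.+1) * (pi * (1 + S))
    + 2 * (-1) ^+ n.+1 * x ^+ (n.+1 * n.+1) * (pi * (1 + x ^+ n.+1)).
  by ring.
rewrite -{}IH.
have tS k : (k <= n)%N ->
    gauss_term n.+1 k = (1 - x ^+ n.+1) * x ^+ k * gauss_term n k.
  move=> le_kn; rewrite /gauss_term euler_rangeSr //.
  by rewrite (_ : k * n.+2 = k + k * n.+1)%N ?exprD; [ring | lia].
have tk k : (k < n)%N ->
    x ^+ n.+1 * (1 + x ^+ k) * gauss_term n k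
    = - gauss_term n k.+1 * (1 - x ^+ k.+1).
  move=> lt_kn; rewrite /gauss_term (euler_rangeSl lt_kn) prodSr //.
  by rewrite [(-1) ^+ k.+1]exprS mulSn exprD; ring.
(* Telescoping, as in the pentagonal case. *)
have tele j : (j <= n)%N -> \sum_(0 <= k < j.+1) gauss_term n.+1 k
    = (1 + x ^+ n.+1) * \sum_(0 <= k < j.+1) gauss_term n k
      - x ^+ n.+1 * (1 + x ^+ j) * gauss_term n j.
  elim: j => [|j IH] le_jn; first by rewrite !big_nat1 tS // expr0; ring.
  rewrite sumSr // IH 1?ltnW // [in RHS]sumSr // tS // tk //; ring.
rewrite tele // -addrA; congr (_ + _).
rewrite /gauss_term !euler_range_nn.
have -> : \prod_(0 <= j < n.+1) (1 + x ^+ j) = 2 * pi.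
  by rewrite big_ltn // expr0 /pi (_ : 1 + 1 = 2).
have -> : x ^+ n.+1 * (1 + x ^+ n) * ((-1) ^+ n * x ^+ (n * n.+1) * 1
    * \prod_(0 <= j < n) (1 + x ^+ j)) = x ^+ n.+1 * ((-1) ^+ n * x ^+ (n * n.+1) * (2 * pi)).
  by rewrite /pi [in RHS](_ : 2 = 1 + 1) // -(expr0 x) -big_ltn // prodSr //; ring.
rewrite (_ : n.+1 * n.+1 = n.+1 + n * n.+1)%N; last by lia.
rewrite (_ : n.+1 * n.+2 = n.+1 + n * n.+1 + n.+1)%N; last by lia.
by rewrite !exprD [(-1) ^+ n.+1]exprS; ring.
Qed.

End Shanks.

(** * Euler's product and its theta series *)

(** The polynomial [(q; q)_n]. *)
Definition euler_poly n : {poly int} := euler_range 'X 0 n.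

(** Euler's product [(q; q)_oo]: the coefficient of order [n] is already that of
    [(q; q)_n], and all later partial products agree with it. *)
Definition euler : fps int := Fps (fun n => (euler_poly n)`_n).

Lemma euler_poly_coef N n : (n <= N)%N -> (euler_poly N)`_n = euler n.
Proof.
move=> /subnK <-; elim: (N - n)%N => [|m IH] //.
rewrite addSn /euler_poly euler_rangeSr // mulrBr mulr1 coefB IH.
by rewrite coefMXn ltnS leq_addl subr0.
Qed.

(** The sign of the pentagonal exponent [(m^2 - 1) / 24], for [m] prime to [6]: it
    is [1] if [m] is [1] or [-1] modulo [12], and [-1] otherwise. *)
Definition pent_sign m : int := if (m %% 12 \in [:: 1; 11])%N then 1 else -1.

Lemma sqr_mod24 m n : (24 * n + 1 = m * m)%N ->
  exists k, (m = 6 * k + 1 \/ (m = 6 * k - 1 /\ 0 < k))%N.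
Proof.
move=> mm; have mE := divn_eq m 6; have := ltn_pmod m (isT : 0 < 6)%N.
move: (m %/ 6)%N (m %% 6)%N mE => a r mE.
case: r mE => [|[|[|[|[|[|r]]]]]] // mE _; subst m.
- lia.
- by exists a; left; lia.
- lia.
- lia.
- lia.
- by exists a.+1; right; lia.
Qed.

Lemma euler_coefE n : euler n = (n == 0%N)%:R
  + \sum_(1 <= k < n.+1) (-1) ^+ k * ((24 * n + 1 == (6 * k - 1) * (6 * k - 1))%N%:R
                                      + (24 * n + 1 == (6 * k + 1) * (6 * k + 1))%N%:R).
Proof.
have <- : (\sum_(0 <= k < n.+1) shanks_term ('X : {poly int}) n k)`_n = euler n.
  rewrite coef_sum big_nat_recl // big_nat big1 ?addr0 => [|k /andP[_ lt_kn]].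
    by rewrite /shanks_term mul0n add0n expr0 mulr1 mul1r.
  by rewrite /shanks_term coefMXn ifT //; nia.
rewrite shanks_pentagonal coefD coef1 coef_sum; congr (_ + _).
apply: eq_big_nat => k /andP[k1 _].
have [e1 e2] := pent_double k.
have -> : (24 * n + 1 == (6 * k - 1) * (6 * k - 1))%N = (n == (k * (3 * k - 1))./2).
  by apply/eqP/eqP; nia.
have -> : (24 * n + 1 == (6 * k + 1) * (6 * k + 1))%N = (n == (k * (3 * k + 1))./2).
  by apply/eqP/eqP; nia.
rewrite -signr_odd -[in RHS]signr_odd !mulr_sign -!coefXn -coefD.
by case: odd; rewrite ?coefN.
Qed.

Lemma sqr_inj (a b : nat) : (a * a = b * b -> a = b)%N.
Proof. by rewrite !mulnn => /eqP; rewrite eqn_exp2r // => /eqP. Qed.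

(** Euler's pentagonal number theorem: the exponents are the [n] such that
    [24 n + 1] is a square. *)
Lemma euler_pent m n : (24 * n + 1 = m * m)%N -> euler n = pent_sign m.
Proof.
move=> mm; have [k km] := sqr_mod24 mm; rewrite euler_coefE.
have sgn b : pent_sign (if b then 6 * k + 1 else 6 * k - 1)%N = (-1) ^+ k \/ (k == 0)%N.
  case: k {km} => [|k]; [by right|left].
  rewrite -signr_odd /pent_sign; have := divn_eq k.+1 2; rewrite modn2.
  by case: (odd k.+1); case: b => kE; set r := (_ %% 12)%N;
    rewrite ?expr0 ?expr1;
    [have -> : r = 7 | have -> : r = 5 | have -> : r = 1 | have -> : r = 11];
    rewrite // /r kE; lia.
have [k0|k_gt0] := posnP k.
  have n0 : n = 0%N by rewrite k0 in km; nia.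
  have m1 : m = 1%N by nia.
  by rewrite n0 m1 big_geq.
have n0 : n != 0%N by nia.
rewrite (negPf n0) add0r (bigD1_seq k) ?iota_uniq //=; last by rewrite mem_index_iota; nia.
rewrite big1 ?addr0 => [|i ik].
  have eqs a : (24 * n + 1 == a * a)%N = (m == a).
    by rewrite mm; apply/eqP/eqP => [/sqr_inj|->].
  rewrite !eqs; case: km => [->|[-> _]].
    rewrite eqxx (_ : (_ == _) = false) ?add0r ?mulr1; last by apply/eqP; lia.
    by case: (sgn true) => [->|/eqP k0] //; lia.
  rewrite eqxx (_ : (_ == _) = false) ?addr0 ?mulr1; last by apply/eqP; lia.
  by case: (sgn false) => [->|/eqP k0] //; lia.
rewrite mm; case: eqP => [/sqr_inj|_]; first by move/eqP: ik; lia.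
case: eqP => [/sqr_inj|_]; first by move/eqP: ik; lia.
by rewrite addr0 mulr0.
Qed.

Lemma euler_notpent n : (forall m, (24 * n + 1)%N <> (m * m)%N) -> euler n = 0.
Proof.
move=> nm; rewrite euler_coefE; case: n nm => [|n] nm; first by case: (nm 1%N).
rewrite add0r big1 // => k _; do 2?(case: eqP => [/nm|_] //).
by rewrite addr0 mulr0.
Qed.

Lemma euler0 : euler 0%N = 1.
Proof. by rewrite (@euler_pent 1). Qed.

Section EulerSections.
Local Notation U := fps_sect.
Local Notation V := (fps_dil 5).

(** The squares modulo [5] leave out the residues that [24 n + 1] takes when [n] is
    congruent to [3] or [4]. *)
Lemma euler_sect3 : U 3 euler = 0.
Proof.
apply: fpsP => n; apply: euler_notpent => m.
have := divn_eq m 5; have := ltn_pmod m (isT : 0 < 5)%N.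
by move: (m %/ 5)%N (m %% 5)%N => a [|[|[|[|[|r]]]]] // _ ->; lia.
Qed.

Lemma euler_sect4 : U 4 euler = 0.
Proof.
apply: fpsP => n; apply: euler_notpent => m.
have := divn_eq m 5; have := ltn_pmod m (isT : 0 < 5)%N.
by move: (m %/ 5)%N (m %% 5)%N => a [|[|[|[|[|r]]]]] // _ ->; lia.
Qed.

Lemma pent_sign5 m e : (24 * e + 1 = m * m)%N -> pent_sign (5 * m) = - pent_sign m.
Proof.
move=> mm; have [k km] := sqr_mod24 mm; rewrite /pent_sign.
have : (m %% 12 \in [:: 1; 5; 7; 11])%N by rewrite !inE; lia.
rewrite -modnMmr; move: (m %% 12)%N => r.
by rewrite !inE => /or4P[] /eqP->.
Qed.

(** If [24 (5 n + 1) + 1 = 25 + 120 n] is a square, that of [5 m] say, then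
    [n = 5 e] with [24 e + 1 = m^2]. *)
Lemma euler_sect1 : U 1 euler = - V euler.
Proof.
apply: fpsP => n; rewrite fps_sectE fpsNE fps_dilE.
have [/dvdnP[e ->]|n5] := boolP (5 %| n)%N; last first.
  rewrite oppr0; apply: euler_notpent => m mm.
  have /dvdnP[a ma] : (5 %| m)%N.
    have : (5 %| m * m)%N by rewrite -mm; apply/dvdnP; exists (24 * n + 5)%N; lia.
    by rewrite Euclid_dvdM // orbb.
  by move: n5; rewrite /dvdn; have : (24 * n + 5 = 5 * (a * a))%N by [nia]; lia.
rewrite mulnK //; have [[m mm]|nm] := pselect (exists m, 24 * e + 1 = m * m)%N.
  by rewrite (euler_pent mm) (@euler_pent (5 * m)) ?(pent_sign5 mm) //; nia.
rewrite (@euler_notpent e) ?oppr0 => [|m mm]; last by apply: nm; exists m.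
apply: euler_notpent => m mm.
have /dvdnP[a ma] : (5 %| m)%N.
  have : (5 %| m * m)%N by rewrite -mm; apply/dvdnP; exists (24 * e * 5 + 5)%N; lia.
  by rewrite Euclid_dvdM // orbb.
by apply: nm; exists a; subst m; nia.
Qed.

(** The theta series [1 + 2 sum_(k >= 1) (-1)^k q^(k^2)]. *)
Definition theta4 : fps int := Fps (fun n => (n == 0%N)%:R
  + \sum_(1 <= k < n.+1) 2 * (-1) ^+ k * (n == k * k)%N%:R).

Lemma theta4_sqr k : (0 < k)%N -> theta4 (k * k)%N = 2 * (-1) ^+ k.
Proof.
move=> k0; rewrite /theta4 /= muln_eq0 orbb (gtn_eqF k0) add0r.
rewrite (bigD1_seq k) ?iota_uniq //=; last by rewrite mem_index_iota; nia.
rewrite eqxx mulr1 big1 ?addr0 // => i ik.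
by case: eqP => [/sqr_inj/eqP|_]; rewrite ?mulr0 // eq_sym (negPf ik).
Qed.

Lemma theta4_notsqr n : (forall k, n <> (k * k)%N) -> theta4 n = 0.
Proof.
move=> nk; case: n nk => [|n] nk; first by case: (nk 0%N).
rewrite /= big1 // ?addr0 // => k _.
by case: eqP => [/nk|_] //; rewrite mulr0.
Qed.

Lemma theta4_trunc N n : (n <= N)%N -> theta4 n
  = (1 + \sum_(1 <= k < N.+1) 2 * (-1) ^+ k * 'X^(k * k) : {poly int})`_n.
Proof.
move=> le_nN; rewrite coefD coef1 coef_sum /=; congr (_ + _).
rewrite [RHS](@big_cat_nat _ _ _ n.+1) //= [X in _ = _ + X]big_nat [X in _ = _ + X]big1 ?addr0.
  apply: eq_bigr => k _.
  rewrite -!mulrA !mulr_natl coefMn -signr_odd -[in RHS]signr_odd !mulr_sign -coefXn.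
  by case: odd; rewrite ?coefN.
move=> k /andP[lt_nk _].
by rewrite coefMXn ifT //; nia.
Qed.

(** Gauss's identity [(q; q)^2 = (q^2; q^2) theta4]. *)
Lemma euler_theta4 : euler ^+ 2 = fps_dil 2 euler * theta4.
Proof.
apply: fpsP => n.
pose P2 := euler_poly n \Po 'X^2.
pose S : {poly int} := 1 + \sum_(1 <= k < n.+1) 2 * (-1) ^+ k * 'X^(k * k).
rewrite (@fpsX_coef _ _ (euler_poly n)); last by move=> i /euler_poly_coef.
rewrite (@fpsM_coef _ _ _ P2 S); first last.
- by move=> i; apply: theta4_trunc.
- move=> i le_in; rewrite fps_dilE coef_comp_poly_Xn //; case: ifP => // _.
  by rewrite euler_poly_coef // (leq_trans (leq_div _ _) le_in).
have -> : P2 * S = euler_poly n * \sum_(0 <= k < n.+1) gauss_term ('X : {poly int}) n k.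
  rewrite shanks_gauss mulrA; congr (_ * _).
  rewrite /P2 /euler_poly /euler_range rmorph_prod -big_split /=.
  apply: eq_bigr => j _; rewrite rmorphB rmorph1 rmorphXn /= comp_polyX -exprM mulnC.
  by rewrite exprM; ring.
rewrite big_nat_recl // mulrDr coefD expr2.
rewrite /gauss_term big_geq // mul0n !expr0 !mul1r mulr1.
rewrite mulr_sumr coef_sum big_nat big1 ?addr0 // => k /andP[_ lt_kn].
by rewrite [_ * 'X^_]mulrC -!mulrA mulrCA mulrC coefMXn ifT //; nia.
Qed.

Lemma theta4_sect2 : U 2 theta4 = 0.
Proof.
apply: fpsP => n; apply: theta4_notsqr => m.
have := divn_eq m 5; have := ltn_pmod m (isT : 0 < 5)%N.
by move: (m %/ 5)%N (m %% 5)%N => a [|[|[|[|[|r]]]]] // _ ->; lia.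
Qed.

Lemma theta4_sect3 : U 3 theta4 = 0.
Proof.
apply: fpsP => n; apply: theta4_notsqr => m.
have := divn_eq m 5; have := ltn_pmod m (isT : 0 < 5)%N.
by move: (m %/ 5)%N (m %% 5)%N => a [|[|[|[|[|r]]]]] // _ ->; lia.
Qed.

Lemma theta4_sect0 : U 0 theta4 = V theta4.
Proof.
apply: fpsP => n; rewrite fps_sectE addn0 fps_dilE.
case: n => [|n]; first by rewrite muln0 dvdn0 div0n.
case: ifP => [/dvdnP[e ne]|n5].
  rewrite ne mulnK //; have [[k ek]|nk] := pselect (exists k, e = k * k)%N.
    have k0 : (0 < k)%N by nia.
    rewrite ek (_ : 5 * (k * k * 5) = (5 * k) * (5 * k))%N; last by lia.
    by rewrite !theta4_sqr // ?muln_gt0 // -signr_odd oddM /= signr_odd.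
  rewrite (@theta4_notsqr e) => [|k ek]; last by apply: nk; exists k.
  apply: theta4_notsqr => k kk.
  have /dvdnP[a ka] : (5 %| k)%N.
    by have : (5 %| k * k)%N by [rewrite -kk dvdn_mulr]; rewrite Euclid_dvdM // orbb.
  by apply: nk; exists a; subst k; nia.
apply: theta4_notsqr => k kk.
have /dvdnP[a ka] : (5 %| k)%N.
  by have : (5 %| k * k)%N by [rewrite -kk dvdn_mulr]; rewrite Euclid_dvdM // orbb.
by move/negP: n5; apply; apply/dvdnP; exists (a * a)%N; subst k; nia.
Qed.

End EulerSections.

(** * The curve relating q and q^2 *)

(** In this part [A, B, C] stand for the components of a dissection
    [f = A(q^5) - q C(q^5) - q^2 B(q^5)], and [A2, B2, C2] for those of [f(q^2)],
    that is [A(q^2), B(q^2), C(q^2)]. The next definition is the section of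
    [f^3 f(q^2)^2] at the exponents congruent to [2] modulo [5]. *)
Definition sect2_f3f2 (R : comNzRingType) (q A B C A2 B2 C2 : R) : R :=
  (A ^+ 3 - 3 * q * B ^+ 2 * C) * (- 2 * A2 * C2)
  + (- 3 * A ^+ 2 * C - q * B ^+ 3) * (q * (2 * B2 * C2))
  + (3 * A * C ^+ 2 - 3 * A ^+ 2 * B) * A2 ^+ 2
  + q * ((6 * A * B * C - C ^+ 3) * (C2 ^+ 2 - 2 * A2 * B2)
         + (3 * A * B ^+ 2 - 3 * B * C ^+ 2) * (q * B2 ^+ 2)).

(** The section of [Y(q^2) f^4] at the exponents congruent to [4] modulo [5], where
    [Y] is the part divisible by [5] of [f^5], divided by [5] ([quint_part] below). *)
Definition sect4_Y2f4 (R : comNzRingType) (q A B C A2 B2 C2 : R) : R :=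
  q ^+ 2 * (4 * A2 * B2 * C2 ^+ 3 - 6 * A2 ^+ 2 * B2 ^+ 2 * C2)
    * (C ^+ 4 - 12 * A * B * C ^+ 2 + 6 * (A * B) ^+ 2)
  + q * (4 * A2 ^+ 3 * B2 * C2 - 2 * A2 ^+ 2 * C2 ^+ 3
         + q ^+ 2 * (A2 * B2 ^+ 4 - 2 * B2 ^+ 3 * C2 ^+ 2))
    * (12 * A ^+ 2 * B * C - 4 * A * C ^+ 3 + q * B ^+ 4)
  + (- A2 ^+ 4 * C2
     + q ^+ 2 * (6 * A2 * B2 ^+ 2 * C2 ^+ 2 - 2 * A2 ^+ 2 * B2 ^+ 3 - B2 * C2 ^+ 4))
    * (6 * A ^+ 2 * C ^+ 2 - 4 * A ^+ 3 * B + 4 * q * B ^+ 3 * C)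
  + q * (A2 * C2 ^+ 4 + 2 * A2 ^+ 3 * B2 ^+ 2 - 6 * A2 ^+ 2 * B2 * C2 ^+ 2
         - q ^+ 2 * B2 ^+ 4 * C2)
    * (- 4 * A ^+ 3 * C + q * (6 * B ^+ 2 * C ^+ 2 - 4 * A * B ^+ 3))
  + (2 * A2 ^+ 3 * C2 ^+ 2 - A2 ^+ 4 * B2
     + q ^+ 2 * (4 * A2 * B2 ^+ 3 * C2 - 2 * B2 ^+ 2 * C2 ^+ 3))
    * (A ^+ 4 + q * (4 * B * C ^+ 3 - 12 * A * B ^+ 2 * C)).

(** The part of [f^5] made of fifth powers, as a function of [q^5]. *)
Definition quintic (R : comNzRingType) (q A B C : R) : R :=
  A ^+ 5 - q * C ^+ 5 - q ^+ 2 * B ^+ 5.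

Section Morphism.
Variables (R S : comNzRingType) (t : {rmorphism R -> S}) (q A B C A2 B2 C2 : R).

Lemma rmorph_sect2_f3f2 : t (sect2_f3f2 q A B C A2 B2 C2)
  = sect2_f3f2 (t q) (t A) (t B) (t C) (t A2) (t B2) (t C2).
Proof.
by rewrite /sect2_f3f2 !(rmorph_nat, rmorphXn, rmorphD, rmorphB, rmorphN, rmorphM).
Qed.

Lemma rmorph_sect4_Y2f4 : t (sect4_Y2f4 q A B C A2 B2 C2)
  = sect4_Y2f4 (t q) (t A) (t B) (t C) (t A2) (t B2) (t C2).
Proof.
by rewrite /sect4_Y2f4 !(rmorph_nat, rmorphXn, rmorphD, rmorphB, rmorphN, rmorphM).
Qed.

Lemma rmorph_quintic : t (quintic q A B C) = quintic (t q) (t A) (t B) (t C).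
Proof. by rewrite /quintic !(rmorphXn, rmorphB, rmorphM). Qed.

End Morphism.

(** Ramanujan's relation. With [r = B / C] and [S = B2 / C2], the hypothesis [rel]
    says that [S (1 - k) = r^2 (1 + k)] where [k = q r S^2], so that [S] and [q] are
    functions of [r] and [k]. Up to powers of [C], [C2] and [r], every quantity of
    interest is a rational function of [k], which in characteristic [5] is a constant
    times a product of powers of [1 + k], [1 - k] and [g = 1 + k - k^2]. *)
Section LevelTen.
Variable K : fieldType.
Variables q A B C A2 B2 C2 : K.
Hypotheses (B0 : B != 0) (C0 : C != 0) (B20 : B2 != 0) (C20 : C2 != 0).
Hypotheses (AB : A * B = C ^+ 2) (AB2 : A2 * B2 = C2 ^+ 2).
Hypothesis rel : A2 * C2 * A ^+ 2
  = (A2 * C) ^+ 2 + q * B2 * C * (A * C2 + A2 * B).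
Let r := B / C.
Let k := q * B * B2 ^+ 2 / (C * C2 ^+ 2).
Hypotheses (k1 : 1 + k != 0) (k1' : 1 - k != 0).

Let r0 : r != 0. Proof. by rewrite mulf_neq0 ?invr_eq0. Qed.
Let AE : A = C / r.
Proof. by rewrite /r; apply: (mulIf B0); rewrite AB; field; rewrite B0 C0. Qed.
Let BE : B = C * r. Proof. by rewrite /r; field. Qed.
Let S := B2 / C2.
Let S0 : S != 0. Proof. by rewrite mulf_neq0 ?invr_eq0. Qed.
Let A2S : A2 = C2 / S.
Proof. by rewrite /S; apply: (mulIf B20); rewrite AB2; field; rewrite B20 C20. Qed.
Let B2S : B2 = C2 * S. Proof. by rewrite /S; field. Qed.
Let kE : k = q * r * S ^+ 2. Proof. by rewrite /k /r /S; field; rewrite C0 C20. Qed.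
Let relS : S * (1 - k) = r ^+ 2 * (1 + k).
Proof.
have : (S * (1 - k) - r ^+ 2 * (1 + k)) = 0; last by move/eqP; rewrite subr_eq0 => /eqP.
have n0 : C ^+ 2 * C2 ^+ 2 / (S ^+ 2 * r ^+ 2) != 0.
  by rewrite !(mulf_neq0, invr_neq0, expf_neq0).
apply: (mulIf n0).
rewrite mul0r; move: rel; rewrite AE BE A2S B2S kE => /eqP; rewrite -subr_eq0 => /eqP <-.
by field; rewrite r0 S0.
Qed.
Let SE : S = r ^+ 2 * (1 + k) / (1 - k).
Proof. by apply: (mulIf k1'); rewrite relS; field. Qed.
Let A2E : A2 = C2 * (1 - k) / (r ^+ 2 * (1 + k)).
Proof. by rewrite A2S SE; field; rewrite r0 k1 k1'. Qed.
Let B2E : B2 = C2 * r ^+ 2 * (1 + k) / (1 - k).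
Proof. by rewrite B2S SE; field. Qed.
Let qE : q = k * (1 - k) ^+ 2 / (r ^+ 5 * (1 + k) ^+ 2).
Proof.
have -> : q = k / (r * S ^+ 2) by rewrite kE; field; rewrite r0 S0.
by rewrite SE; field; rewrite r0 k1 k1'.
Qed.

Hypothesis char5 : 5 = 0 :> K.
Let mod5 (x y z : K) : x = y + 5 * z -> x = y.
Proof. by rewrite char5 mul0r addr0. Qed.
Let g := 1 + k - k ^+ 2.

(* In the next four proofs, the multiple of [5] is the difference of the two sides,
   expanded in [r] and [k] over the rational numbers. *)
Let WE : sect2_f3f2 q A B C A2 B2 C2
  = 3 * C ^+ 3 * C2 ^+ 2 * g ^+ 2 * (1 - k) / (r ^+ 5 * (1 + k) ^+ 3).
Proof.
apply: (@mod5 _ _ (C ^+ 3 * C2 ^+ 2 / (r ^+ 5 * (1 + k) ^+ 3)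
  * (- 1 - 2 * k - 2 * k ^+ 2 + 8 * k ^+ 3 - 4 * k ^+ 4 + k ^+ 5))).
rewrite /g AE BE A2E B2E qE; move: k r k1 k1' r0 => k' r' h1 h2 h3.
by rewrite /sect2_f3f2; field; rewrite h1 h2 h3.
Qed.

Let PE : quintic q A B C = C ^+ 5 * g ^+ 3 / (r ^+ 5 * (1 + k) ^+ 4).
Proof.
apply: (@mod5 _ _ (C ^+ 5 / (r ^+ 5 * (1 + k) ^+ 4) * (k ^+ 2 + 3 * k ^+ 3 - k ^+ 4))).
rewrite /g AE BE qE; move: k r k1 r0 => k' r' h1 h3.
by rewrite /quintic; field; rewrite h1 h3.
Qed.

Let P2E : quintic (q ^+ 2) A2 B2 C2
  = C2 ^+ 5 * g ^+ 3 * (1 - k) ^+ 3 / (r ^+ 10 * (1 + k) ^+ 5).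
Proof.
apply: (@mod5 _ _ (C2 ^+ 5 / (r ^+ 10 * (1 + k) ^+ 5) * (- k + 3 * k ^+ 2 - 2 * k ^+ 3
  - 2 * k ^+ 4 + 2 * k ^+ 5 + 2 * k ^+ 6 - 3 * k ^+ 7 + k ^+ 8))).
rewrite /g A2E B2E qE; move: k r k1 k1' r0 => k' r' h1 h2 h3.
by rewrite /quintic; field; rewrite h1 h2 h3.
Qed.

Let ZE : sect4_Y2f4 q A B C A2 B2 C2 + 2 * C ^+ 4 * quintic (q ^+ 2) A2 B2 C2
  = C ^+ 4 * C2 ^+ 5 * g ^+ 4 * (1 - k) ^+ 2 / (r ^+ 10 * (1 + k) ^+ 6).
Proof.
apply: (@mod5 _ _ (C ^+ 4 * C2 ^+ 5 / (r ^+ 10 * (1 + k) ^+ 6) * (2 * k + 10 * k ^+ 2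
  - 32 * k ^+ 3 + 17 * k ^+ 4 + 18 * k ^+ 5 - 7 * k ^+ 6 - 24 * k ^+ 7 + 18 * k ^+ 8
  - 2 * k ^+ 9))).
rewrite /g AE BE A2E B2E qE; move: k r k1 k1' r0 => k' r' h1 h2 h3.
by rewrite /sect4_Y2f4 /quintic; field; rewrite h1 h2 h3.
Qed.

Lemma sect2_f3f2_cube : (2 * sect2_f3f2 q A B C A2 B2 C2) ^+ 3
  = quintic q A B C * quintic (q ^+ 2) A2 B2 C2 * C ^+ 4 * C2.
Proof.
rewrite WE PE P2E; move: g k r k1 r0 => g' k' r' h1 h3.
(* [6^3 = 1 + 5 * 43] *)
apply: (@mod5 _ _ (43 * C ^+ 9 * C2 ^+ 6 * g' ^+ 6 * (1 - k') ^+ 3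
  / (r' ^+ 15 * (1 + k') ^+ 9))).
by field; rewrite h1 h3.
Qed.

Lemma sect4_Y2f4_square :
  C ^+ 2 * (sect4_Y2f4 q A B C A2 B2 C2 + 2 * C ^+ 4 * quintic (q ^+ 2) A2 B2 C2)
  = - C2 * sect2_f3f2 q A B C A2 B2 C2 ^+ 2.
Proof.
rewrite ZE WE; move: g k r k1 r0 => g' k' r' h1 h3.
(* [1 = - 3^2 + 5 * 2] *)
apply: (@mod5 _ _ (2 * C ^+ 6 * C2 ^+ 5 * g' ^+ 4 * (1 - k') ^+ 2
  / (r' ^+ 10 * (1 + k') ^+ 6))).
by field; rewrite h1 h3.
Qed.

End LevelTen.

(** * Sections of powers *)

Section Dissection.
Local Notation U := fps_sect.
Local Notation V := (fps_dil 5).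
Local Notation D2 := (fps_dil 2).

(** A series whose sections modulo [5] are those of Euler's product:
    [f = A(q^5) - q C(q^5) - q^2 B(q^5)]. *)
Definition euler_dissection (R : comNzRingType) (f A B C : fps R) :=
  [/\ U 0 f = A, U 1 f = - C, U 2 f = - B, U 3 f = 0 & U 4 f = 0].

Section Powers.
Variables (R : comNzRingType) (f A B C : fps R).
Hypothesis df : euler_dissection f A B C.
Local Notation q := (fpsq R).

Lemma dissection_eq : f = V A - q * V C - q ^+ 2 * V B.
Proof.
case: df => h0 h1 h2 h3 h4; rewrite {1}[f]sect_dec h0 h1 h2 h3 h4.
by rewrite !rmorphN !rmorph0; ring.
Qed.

Lemma sect_exp2 :
  [/\ U 0 (f ^+ 2) = A ^+ 2, U 1 (f ^+ 2) = - 2 * A * C,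
      U 2 (f ^+ 2) = C ^+ 2 - 2 * A * B, U 3 (f ^+ 2) = 2 * B * C &
      U 4 (f ^+ 2) = B ^+ 2].
Proof.
case: df => h0 h1 h2 h3 h4; rewrite expr2.
have [-> -> -> -> ->] := sectM f f; rewrite h0 h1 h2 h3 h4.
by split; ring.
Qed.

Lemma sect_exp3 :
  [/\ U 0 (f ^+ 3) = A ^+ 3 - 3 * q * B ^+ 2 * C,
      U 1 (f ^+ 3) = - 3 * A ^+ 2 * C - q * B ^+ 3,
      U 2 (f ^+ 3) = 3 * A * C ^+ 2 - 3 * A ^+ 2 * B,
      U 3 (f ^+ 3) = 6 * A * B * C - C ^+ 3 &
      U 4 (f ^+ 3) = 3 * A * B ^+ 2 - 3 * B * C ^+ 2].
Proof.
have [k0 k1 k2 k3 k4] := sect_exp2; case: df => h0 h1 h2 h3 h4; rewrite exprS.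
have [-> -> -> -> ->] := sectM f (f ^+ 2).
by rewrite h0 h1 h2 h3 h4 k0 k1 k2 k3 k4; split; ring.
Qed.

Lemma sect_exp4 :
  [/\ U 0 (f ^+ 4) = A ^+ 4 + q * (4 * B * C ^+ 3 - 12 * A * B ^+ 2 * C),
      U 1 (f ^+ 4) = - 4 * A ^+ 3 * C + q * (6 * B ^+ 2 * C ^+ 2 - 4 * A * B ^+ 3),
      U 2 (f ^+ 4) = 6 * A ^+ 2 * C ^+ 2 - 4 * A ^+ 3 * B + 4 * q * B ^+ 3 * C,
      U 3 (f ^+ 4) = 12 * A ^+ 2 * B * C - 4 * A * C ^+ 3 + q * B ^+ 4 &
      U 4 (f ^+ 4) = C ^+ 4 - 12 * A * B * C ^+ 2 + 6 * (A * B) ^+ 2].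
Proof.
have [k0 k1 k2 k3 k4] := sect_exp2; rewrite (exprM f 2 2) expr2.
have [-> -> -> -> ->] := sectM (f ^+ 2) (f ^+ 2).
by rewrite k0 k1 k2 k3 k4; split; ring.
Qed.

Hypothesis AB : A * B = C ^+ 2.

Lemma sect4_exp4 : U 4 (f ^+ 4) = - 5 * C ^+ 4.
Proof. by have [_ _ _ _ ->] := sect_exp4; rewrite -[12 * A * B]mulrA AB; ring. Qed.

Lemma sect3_exp3 : U 3 (f ^+ 3) = 5 * C ^+ 3.
Proof. by have [_ _ _ -> _] := sect_exp3; rewrite -[6 * A * B]mulrA AB; ring. Qed.

Lemma sect2_exp2 : U 2 (f ^+ 2) = - C ^+ 2.
Proof. by have [_ _ -> _ _] := sect_exp2; rewrite -[2 * A * B]mulrA AB; ring. Qed.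

Lemma sect3_exp8 : U 3 (f ^+ 8) = - 125 * q * C ^+ 8.
Proof.
have [k0 k1 k2 k3 k4] := sect_exp4; rewrite (exprM f 4 2) expr2.
have [_ _ _ -> _] := sectM (f ^+ 4) (f ^+ 4); rewrite k0 k1 k2 k3 k4.
set lhs := LHS; set s := A * B.
have -> : lhs = q * (70 * s ^+ 4 - 560 * s ^+ 3 * C ^+ 2 + 420 * s ^+ 2 * C ^+ 4
    - 56 * s * C ^+ 6 + C ^+ 8) + 56 * C * (A ^+ 5 - q ^+ 2 * B ^+ 5) * (s - C ^+ 2).
  by rewrite /lhs /s; ring.
by rewrite /s AB; ring.
Qed.

(** The terms of [(x + y + z)^5] other than the fifth powers, divided by [5], for
    [x = A(q^5)], [y = - q C(q^5)] and [z = - q^2 B(q^5)]. *)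
Definition quint_part : fps R :=
  V (q * (4 * A * B * C ^+ 3 - 6 * A ^+ 2 * B ^+ 2 * C))
  + q * V (- A ^+ 4 * C
      + q * (6 * A * B ^+ 2 * C ^+ 2 - 2 * A ^+ 2 * B ^+ 3 - B * C ^+ 4))
  + q ^+ 2 * V (2 * A ^+ 3 * C ^+ 2 - A ^+ 4 * B
      + q * (4 * A * B ^+ 3 * C - 2 * B ^+ 2 * C ^+ 3))
  + q ^+ 3 * V (4 * A ^+ 3 * B * C - 2 * A ^+ 2 * C ^+ 3
      + q * (A * B ^+ 4 - 2 * B ^+ 3 * C ^+ 2))
  + q ^+ 4 * V (A * C ^+ 4 + 2 * A ^+ 3 * B ^+ 2 - 6 * A ^+ 2 * B * C ^+ 2
      - q * B ^+ 4 * C).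

Lemma exp5_dissection : f ^+ 5 = V (quintic q A B C) + 5 * quint_part.
Proof.
rewrite dissection_eq /quintic /quint_part.
rewrite !(rmorph_nat, rmorphXn, rmorphD, rmorphB, rmorphN, rmorphM) /= fps_dilq //.
by ring.
Qed.

Lemma sect_quint_part :
  [/\ U 0 quint_part = q * (4 * A * B * C ^+ 3 - 6 * A ^+ 2 * B ^+ 2 * C),
      U 1 quint_part = - A ^+ 4 * C
        + q * (6 * A * B ^+ 2 * C ^+ 2 - 2 * A ^+ 2 * B ^+ 3 - B * C ^+ 4),
      U 2 quint_part = 2 * A ^+ 3 * C ^+ 2 - A ^+ 4 * B
        + q * (4 * A * B ^+ 3 * C - 2 * B ^+ 2 * C ^+ 3),
      U 3 quint_part = 4 * A ^+ 3 * B * C - 2 * A ^+ 2 * C ^+ 3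
        + q * (A * B ^+ 4 - 2 * B ^+ 3 * C ^+ 2) &
      U 4 quint_part = A * C ^+ 4 + 2 * A ^+ 3 * B ^+ 2 - 6 * A ^+ 2 * B * C ^+ 2
        - q * B ^+ 4 * C].
Proof. by split; rewrite sect_sum. Qed.

Lemma sect4_quint_exp4 : U 4 (quint_part * f ^+ 4)
  = - 17 * C ^+ 4 * quintic q A B C + 55 * q * C ^+ 9.
Proof.
have [k0 k1 k2 k3 k4] := sect_exp4; have [y0 y1 y2 y3 y4] := sect_quint_part.
have [_ _ _ _ ->] := sectM quint_part (f ^+ 4).
rewrite k0 k1 k2 k3 k4 y0 y1 y2 y3 y4 /quintic; set l := LHS; pose s := A * B.
have -> : l = (A ^+ 5 - q ^+ 2 * B ^+ 5) * (6 * s ^+ 2 - 48 * s * C ^+ 2 + 25 * C ^+ 4)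
    + q * (336 * s ^+ 3 * C ^+ 3 - 126 * s ^+ 4 * C - 150 * s ^+ 2 * C ^+ 5
           + 12 * s * C ^+ 7).
  by rewrite /l /s; ring.
by rewrite /s AB; ring.
Qed.

Lemma sect4_dil2_quint_exp4 : U 4 (D2 quint_part * f ^+ 4)
  = sect4_Y2f4 q A B C (D2 A) (D2 B) (D2 C).
Proof.
have [k0 k1 k2 k3 k4] := sect_exp4; have [y0 y1 y2 y3 y4] := sect_quint_part.
have [s0 s1 s2 s3 s4] := sect_dil2 quint_part.
have [_ _ _ _ ->] := sectM (D2 quint_part) (f ^+ 4).
rewrite s0 s1 s2 s3 s4 k0 k1 k2 k3 k4 y0 y1 y2 y3 y4 /sect4_Y2f4.
by rewrite !(rmorph_nat, rmorphXn, rmorphD, rmorphB, rmorphN, rmorphM) /= fps_dilq //.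
Qed.

Lemma sect2_exp3_dil2 : U 2 (f ^+ 3 * D2 f ^+ 2)
  = sect2_f3f2 q A B C (D2 A) (D2 B) (D2 C).
Proof.
have [k0 k1 k2 k3 k4] := sect_exp3; have [y0 y1 y2 y3 y4] := sect_exp2.
have [s0 s1 s2 s3 s4] := sect_dil2 (f ^+ 2).
rewrite -rmorphXn; have [_ _ -> _ _] := sectM (f ^+ 3) (D2 (f ^+ 2)).
rewrite s0 s1 s2 s3 s4 k0 k1 k2 k3 k4 y0 y1 y2 y3 y4 /sect2_f3f2.
rewrite !(rmorph_nat, rmorphXn, rmorphD, rmorphB, rmorphN, rmorphM) /=.
by move: (D2 A) (D2 B) (D2 C) => A2 B2 C2; ring.
Qed.

End Powers.

Section EulerDissection.
Local Notation E := euler.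
Local Notation q := (fpsq int).
(** The components [A] and [B] of the dissection of Euler's product; the component
    [C] is [V euler]. *)
Definition eulerA := U 0 E.
Definition eulerB : fps int := Fps (fun n => - E (5 * n + 2)%N).

Lemma euler_sect2 : U 2 E = - eulerB.
Proof. by apply: fpsP => n; rewrite fpsNE /= opprK. Qed.

Lemma euler_dissectionP : euler_dissection E eulerA eulerB (V E).
Proof. by split; rewrite ?euler_sect2 ?euler_sect1 ?euler_sect3 ?euler_sect4. Qed.

Lemma mul2I (f g : fps int) : 2 * f = 2 * g -> f = g.
Proof.
by apply: mulfI; apply/eqP => /(congr1 (fun f : fps int => f 0%N)); rewrite fps_nat0.
Qed.

(** The section of Gauss's identity at the exponents congruent to [2] modulo [5]
    reads [C^2 - 2 A B = - C^2]. *)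
Lemma eulerAB : eulerA * eulerB = V E ^+ 2.
Proof.
have [_ _ e2 _ _] := sect_exp2 euler_dissectionP.
have [_ _ d2 _ _] := sectM (D2 E) theta4.
have [_ s1 s2 s3 s4] := sect_dil2 E.
move: e2; rewrite euler_theta4 d2 s1 s2 s3 s4 theta4_sect2 theta4_sect3 theta4_sect0.
rewrite euler_sect1 euler_sect3 euler_sect4 !rmorphN !rmorph0 /= fps_dilC //.
have VE2 : V E ^+ 2 = V (D2 E) * V theta4 by rewrite -rmorphM -euler_theta4 rmorphXn.
move=> h; apply: mul2I; rewrite mulrA.
have -> : 2 * eulerA * eulerB = V E ^+ 2 - (V E ^+ 2 - 2 * eulerA * eulerB) by ring.
by rewrite -h VE2; ring.
Qed.

(** The sections of Gauss's identity at the exponents congruent to [0], [1] and [3]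
    modulo [5], after elimination of those of the theta series. *)
Lemma eulerAB2 :
  D2 eulerA * D2 (V E) * eulerA ^+ 2 = (D2 eulerA * V E) ^+ 2
    + q * D2 eulerB * V E * (eulerA * D2 (V E) + D2 eulerA * eulerB).
Proof.
have [e0 e1 e2 e3 e4] := sect_exp2 euler_dissectionP.
have [d0 d1 d2 d3 d4] := sectM (D2 E) theta4.
have [s0 s1 s2 s3 s4] := sect_dil2 E.
have U2E := euler_sect2.
have VE2 : V E ^+ 2 = D2 (V E) * V theta4.
  by rewrite fps_dilC // -rmorphM -euler_theta4 rmorphXn.
have AB2 : D2 eulerA * D2 eulerB = D2 (V E) ^+ 2 by rewrite -rmorphM eulerAB rmorphXn.
move: U2E (erefl : U 0 E = eulerA) AB2 e0 e1 e3; move: eulerA eulerB => A B U2E U0E AB2.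
rewrite euler_theta4 d0 d1 d3 s0 s1 s2 s3 s4 theta4_sect2 theta4_sect3 theta4_sect0.
rewrite U0E U2E euler_sect1 euler_sect3 euler_sect4 !rmorphN !rmorph0 /=.
move: (D2 A) (D2 B) (V E) (D2 (V E)) (V theta4) (U 1 theta4) (U 4 theta4) AB2 VE2.
move=> A2 B2 C C2 T0 T1 T4 AB2 CC h0 h1 h3.
have k : 2 * (A2 * C2 * T1) = - C * (2 * (A * C2 + A2 * B)).
  have -> : - C * (2 * (A * C2 + A2 * B)) = C2 * (- 2 * A * C) - A2 * (2 * B * C) by ring.
  rewrite -h1 -h3; apply/eqP; rewrite -subr_eq0; set w := (w in w == 0).
  have -> : w = q * T4 * (C2 ^+ 2 - A2 * B2) by rewrite /w; ring.
  by rewrite AB2 subrr mulr0.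
rewrite -h0 exprMn CC.
set l := LHS.
have -> : l = A2 ^+ 2 * (C2 * T0) - q * B2 * (A2 * C2 * T1) by rewrite /l; ring.
apply: mul2I; rewrite mulrBr [2 * (q * B2 * _)]mulrCA k; ring.
Qed.

End EulerDissection.

End Dissection.

(** * Reduction modulo 5 *)

Section Mod5Series.
Local Notation U := fps_sect.
Local Notation V := (fps_dil 5).
Local Notation D2 := (fps_dil 2).
Local Notation F5 := 'F_5.
Local Notation q := (fpsq F5).

(** Reduction of the coefficients modulo [5]. *)
Local Notation red := (map_fps (intmul 1 : {rmorphism int -> F5})).

Lemma red_dil s f : red (fps_dil s f) = fps_dil s (red f).
Proof. exact: map_fps_dil. Qed.
Lemma red_sect c f : red (U c f) = U c (red f).
Proof. exact: map_fps_sect. Qed.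
Lemma redq : red (fpsq int) = q.
Proof. exact: map_fpsq. Qed.

Lemma F5_char : 5%N \in [pchar F5].
Proof. exact: pchar_Fp. Qed.

Lemma red_eq0 f : red f = 0 -> exists g, f = 5 * g.
Proof.
move=> f0; exists (Fps (fun n => (f n %/ 5)%Z)); apply: fpsP => n.
have f5 : (5 %| f n)%Z.
  have := congr1 (fun f : fps F5 => f n) f0; rewrite /= => /eqP.
  by rewrite -(dvdz_pcharf F5_char).
by rewrite mulr_natl fpsMnE -[LHS](divzK f5) -[RHS]mulr_natr natz.
Qed.

Lemma fps5_char : (5 : fps F5) = 0.
Proof. by apply: fpsP => n; rewrite fpsMnE -mulr_natl (pcharf0 F5_char) mul0r. Qed.

Lemma poly_frobenius (p : {poly F5}) : p ^+ 5 = p \Po 'X^5.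
Proof.
elim/poly_ind: p => [|p c IH]; first by rewrite comp_poly0 expr0n.
rewrite comp_polyD comp_polyM comp_polyX comp_polyC -IH.
rewrite -!(pFrobenius_autE (rmorph_pchar (polyC : {rmorphism F5 -> {poly F5}}) F5_char)).
rewrite rmorphD rmorphM /= !pFrobenius_autE -rmorphXn /=; congr (_ + _%:P).
by have := expf_card c; rewrite card_Fp.
Qed.

(** The Frobenius identity [f(q)^5 = f(q^5)] modulo [5]. *)
Lemma fps_frobenius (f : fps F5) : f ^+ 5 = V f.
Proof.
apply: fpsP => n; rewrite (@fpsX_coef _ _ (fps_trunc n.+1 f)) => [|i le_in].
  rewrite poly_frobenius coef_comp_poly_Xn // fps_dilE; case: ifP => // _.
  by rewrite coef_trunc // ltnS leq_div.
by rewrite coef_trunc.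
Qed.

Lemma fps_dilI s (f g : fps F5) : (0 < s)%N -> fps_dil s f = fps_dil s g -> f = g.
Proof.
move=> s0 fg; apply: fpsP => n.
by have := congr1 (fun h : fps F5 => h (n * s)%N) fg; rewrite /= dvdn_mull // mulnK.
Qed.

(** Euler's product and the components of its dissection, modulo [5]. *)
Definition eulerF := red euler.
Definition eulerFA := red eulerA.
Definition eulerFB := red eulerB.
Local Notation e := eulerF.
Local Notation a := eulerFA.
Local Notation b := eulerFB.

Lemma eulerF_dissection : euler_dissection e a b (V e).
Proof.
have [h0 h1 h2 h3 h4] := euler_dissectionP.
by split; rewrite /eulerF -red_sect ?h0 ?h1 ?h2 ?h3 ?h4 ?rmorphN ?rmorph0 /= ?red_dil.
Qed.

Lemma eulerF_AB : a * b = V e ^+ 2.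
Proof. by rewrite /eulerF -red_dil -rmorphM eulerAB rmorphXn. Qed.

Lemma eulerF_AB2 : D2 a * D2 b = D2 (V e) ^+ 2.
Proof. by rewrite -rmorphM eulerF_AB rmorphXn. Qed.

Lemma eulerF_rel : D2 a * D2 (V e) * a ^+ 2 = (D2 a * V e) ^+ 2
    + q * D2 b * V e * (a * D2 (V e) + D2 a * b).
Proof.
have := congr1 red eulerAB2.
by rewrite !(rmorphD, rmorphM, rmorphXn) /= !red_dil redq.
Qed.

(** Modulo [5], [quintic] of the dissection is the series itself, since
    [f(q)^5 = f(q^5)]. *)
Lemma eulerF_quintic : quintic q a b (V e) = e.
Proof.
apply: (@fps_dilI 5) => //; rewrite -[RHS]fps_frobenius (exp5_dissection eulerF_dissection).
by rewrite fps5_char mul0r addr0.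
Qed.

Lemma eulerF_quintic2 : quintic (q ^+ 2) (D2 a) (D2 b) (D2 (V e)) = D2 e.
Proof.
by rewrite -[in RHS]eulerF_quintic rmorph_quintic /= fps_dilq.
Qed.

Lemma eulerF0 : e 0%N = 1.
Proof. by change ((euler 0%N)%:~R = 1 :> F5); rewrite euler0. Qed.
Lemma eulerFA0 : a 0%N = 1.
Proof. by change ((euler 0%N)%:~R = 1 :> F5); rewrite euler0. Qed.
Lemma eulerFB0 : b 0%N = 1.
Proof. by change ((- euler 2%N)%:~R = 1 :> F5); rewrite (@euler_pent 7). Qed.

Lemma fps1_neq0 (f : fps F5) : f 0%N = 1 -> f != 0.
Proof. by move=> f1; apply/eqP => f0; rewrite f0 in f1. Qed.

Local Notation W := (sect2_f3f2 q a b (V e) (D2 a) (D2 b) (D2 (V e))).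
Local Notation Z := (sect4_Y2f4 q a b (V e) (D2 a) (D2 b) (D2 (V e))).

(** The relations of the parametrized curve, for Euler's product. They are proved in a
    field that contains the ring of power series. *)
Lemma level10_relations_embed (K : fieldType) (t : {rmorphism fps F5 -> K}) :
    injective t ->
  (2 * W) ^+ 3 = e * D2 e * V e ^+ 4 * D2 (V e)
  /\ V e ^+ 2 * (Z + 2 * V e ^+ 4 * D2 e) = - D2 (V e) * W ^+ 2.
Proof.
move=> tI.
have t0 (x : fps F5) : x 0%N = 1 -> t x != 0 by move/fps1_neq0; rewrite -(inj_eq tI) rmorph0.
have char5 : 5 = 0 :> K by rewrite -(rmorph_nat t) fps5_char rmorph0.
have a1 := eulerFA0; have b1 := eulerFB0; have e1 := eulerF0.
have c1 : V e 0%N = 1 by [].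
have c21 : D2 (V e) 0%N = 1 by [].
(* The parameter [k] is [m / n], where [m] has no constant term, so that neither
   [1 + k] nor [1 - k] vanishes. *)
pose n := V e * D2 (V e) ^+ 2; pose m := q * (b * D2 b ^+ 2).
have n1 : n 0%N = 1 by rewrite fpsM0 fpsX0 c1 c21 mul1r expr1n.
have m0 : m 0%N = 0 by rewrite fpsM0 /= coefX mul0r.
have kE : t q * t b * t (D2 b) ^+ 2 / (t (V e) * t (D2 (V e)) ^+ 2) = t m / t n.
  by rewrite /m /n !(rmorphXn, rmorphM) /= !mulrA.
have tn0 : t n != 0 by apply: t0.
have k1 : 1 + t m / t n != 0.
  apply: contraNneq (t0 (n + m) _) => [h|]; last by rewrite fpsDE n1 m0 addr0.
  by rewrite rmorphD -(mulfK tn0 (t m)) mulrAC -{1}[t n]mul1r -mulrDl h mul0r.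
have k2 : 1 - t m / t n != 0.
  apply: contraNneq (t0 (n - m) _) => [h|]; last by rewrite fpsBE n1 m0 subr0.
  by rewrite rmorphB -(mulfK tn0 (t m)) mulrAC -{1}[t n]mul1r -mulrBl h mul0r.
rewrite -kE in k1 k2.
have P1 : quintic (t q) (t a) (t b) (t (V e)) = t e.
  by rewrite -[in RHS]eulerF_quintic rmorph_quintic.
have P2 : quintic (t q ^+ 2) (t (D2 a)) (t (D2 b)) (t (D2 (V e))) = t (D2 e).
  by rewrite -[in RHS]eulerF_quintic2 rmorph_quintic rmorphXn.
have tW : t W = sect2_f3f2 (t q) (t a) (t b) (t (V e)) (t (D2 a)) (t (D2 b)) (t (D2 (V e))).
  exact: rmorph_sect2_f3f2.
have tZ : t Z = sect4_Y2f4 (t q) (t a) (t b) (t (V e)) (t (D2 a)) (t (D2 b)) (t (D2 (V e))).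
  exact: rmorph_sect4_Y2f4.
have tab : t a * t b = t (V e) ^+ 2 by rewrite -rmorphM eulerF_AB rmorphXn.
have tab2 : t (D2 a) * t (D2 b) = t (D2 (V e)) ^+ 2 by rewrite -rmorphM eulerF_AB2 rmorphXn.
have trel : t (D2 a) * t (D2 (V e)) * t a ^+ 2 = (t (D2 a) * t (V e)) ^+ 2
    + t q * t (D2 b) * t (V e) * (t a * t (D2 (V e)) + t (D2 a) * t b).
  by move: (congr1 t eulerF_rel); rewrite !(rmorphXn, rmorphD, rmorphM).
move: W Z tW tZ => w z tW tZ; split; apply: tI.
  rewrite !(rmorphXn, rmorphM, rmorph_nat) tW.
  have := sect2_f3f2_cube _ _ _ _ tab tab2 trel k1 k2 char5; rewrite P1 P2; apply.
  1-4: by apply: t0.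
rewrite !(rmorph_nat, rmorphXn, rmorphN, rmorphM, rmorphD) tW tZ.
have := sect4_Y2f4_square _ _ _ _ tab tab2 trel k1 k2 char5; rewrite P2; apply.
all: by apply: t0.
Qed.

Lemma level10_relations :
  (2 * W) ^+ 3 = e * D2 e * V e ^+ 4 * D2 (V e)
  /\ V e ^+ 2 * (Z + 2 * V e ^+ 4 * D2 e) = - D2 (V e) * W ^+ 2.
Proof.
apply: (@level10_relations_embed _ (@tofrac (fps F5))).
by move=> x y /eqP; rewrite tofrac_eq => /eqP.
Qed.

(** Series with constant term [1] have unique cube roots: [x^2 + x y + y^2] has
    constant term [3]. *)
Lemma fps_cube_inj (x y : fps F5) : x 0%N = 1 -> y 0%N = 1 -> x ^+ 3 = y ^+ 3 -> x = y.
Proof.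
move=> x1 y1 xy; have /eqP : (x - y) * (x ^+ 2 + x * y + y ^+ 2) = 0.
  by rewrite -[0](subrr (y ^+ 3)) -{1}xy; ring.
rewrite mulf_eq0 subr_eq0 => /orP[/eqP //|/eqP /(congr1 (fun f : fps F5 => f 0%N))].
by rewrite !fpsDE !fpsX0 fpsM0 x1 y1 !expr1n mulr1.
Qed.

Lemma eulerF_dil25 : D2 (V e) = D2 e ^+ 5.
Proof. by rewrite -fps_frobenius rmorphXn. Qed.

Lemma sect2_eulerF_const : fps_const (2 * W) = 1.
Proof.
have q0 : fps_const q = 0 by rewrite /fps_const /= coefX.
have V0 f s : fps_const (fps_dil s f) = fps_const f :> F5.
  by rewrite /fps_const fps_dilE dvdn0 div0n.
have a1 : fps_const a = 1 := eulerFA0.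
have b1 : fps_const b = 1 := eulerFB0.
have e1 : fps_const e = 1 := eulerF0.
transitivity (2 * sect2_f3f2 (0 : F5) 1 1 1 1 1 1).
  rewrite rmorphM rmorph_nat; congr (_ * _).
  transitivity (sect2_f3f2 (fps_const q) (fps_const a) (fps_const b) (fps_const (V e))
    (fps_const (D2 a)) (fps_const (D2 b)) (fps_const (D2 (V e)))).
    exact: rmorph_sect2_f3f2.
  by rewrite q0 !V0 a1 b1 e1.
rewrite /sect2_f3f2.
set w := LHS; have -> : w = 1 - 5%:R by rewrite /w; ring.
by rewrite (pcharf0 F5_char) subr0.
Qed.

(** [U_2 (E(q)^3 E(q^2)^2) = 3 E(q)^7 E(q^2)^2] modulo [5]: the cube of this
    equation is the first relation above, as [E(q^5) = E(q)^5]. *)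
Lemma sect2_eulerF_e3e2 : W = 3 * e ^+ 7 * D2 e ^+ 2.
Proof.
have h : 2 * W = e ^+ 7 * D2 e ^+ 2.
  apply: fps_cube_inj; first exact: sect2_eulerF_const.
    by rewrite fpsM0 !fpsX0 fps_dilE dvdn0 div0n eulerF0 !expr1n mulr1.
  rewrite (level10_relations.1) eulerF_dil25 -fps_frobenius.
  by move: e (D2 e) => x y; ring.
move: W h => w h; rewrite -mulrA -h.
have -> : 3 * (2 * w) = w + 5 * w by ring.
by rewrite fps5_char mul0r addr0.
Qed.

(** [U_4 (Y(q^2) E^4)] modulo [5], from the second relation. *)
Lemma sect4_eulerF_Y2e4 : Z = e ^+ 4 * D2 e ^+ 9 - 2 * V e ^+ 4 * D2 e.
Proof.
apply/eqP; rewrite eq_sym subr_eq eq_sym; apply/eqP.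
have c0 : V e ^+ 2 != 0.
  by apply: fps1_neq0; rewrite fpsX0 fps_dilE dvdn0 div0n eulerF0 expr1n.
apply: (mulfI c0); rewrite (level10_relations.2) sect2_eulerF_e3e2 eulerF_dil25.
rewrite -fps_frobenius; set l := LHS.
have -> : l = (e ^+ 5) ^+ 2 * (e ^+ 4 * D2 e ^+ 9) - 5 * (2 * e ^+ 14 * D2 e ^+ 9).
  by rewrite /l; ring.
by rewrite fps5_char mul0r subr0.
Qed.

(** * Congruences for formal quotients *)

(* Keeps unification from computing coefficients. *)
Opaque eulerF euler.

Lemma eulerF_neq0 : e != 0. Proof. by apply: fps1_neq0; exact: eulerF0. Qed.

Lemma dil5_eulerF2X r : V (D2 e ^+ r) = D2 e ^+ (5 * r).
Proof. by rewrite -fps_frobenius -exprM mulnC. Qed.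

Lemma dil5_eulerFX r : V (e ^+ r) = e ^+ (5 * r).
Proof. by rewrite -fps_frobenius -exprM mulnC. Qed.

Lemma sect4_eulerF4 : U 4 (e ^+ 4) = 0.
Proof. by rewrite (sect4_exp4 eulerF_dissection eulerF_AB) mulNr fps5_char mul0r oppr0. Qed.

Lemma sect1_eulerF2_3 : U 1 (D2 e ^+ 3) = 0.
Proof.
have [_ h _ _ _] := sect_dil2 (e ^+ 3).
by rewrite -rmorphXn h (sect3_exp3 eulerF_dissection eulerF_AB) fps5_char mul0r rmorph0 mulr0.
Qed.

Lemma sect3_eulerF2_4 : U 3 (D2 e ^+ 4) = 0.
Proof.
have [_ _ _ h _] := sect_dil2 (e ^+ 4).
by rewrite -rmorphXn h sect4_eulerF4 rmorph0 mulr0.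
Qed.

Lemma sect3_eulerF_eulerF2 : U 3 (e * D2 e) = V e * D2 (V e).
Proof.
have [_ _ _ -> _] := sectM e (D2 e); have [s0 s1 s2 s3 s4] := sect_dil2 e.
have [h0 h1 h2 h3 h4] := eulerF_dissection.
by rewrite s0 s1 s2 s3 s4 h0 h1 h2 h3 h4 !rmorph0 rmorphN /=; ring.
Qed.

Lemma eulerF_mul_eq0 r (f : fps F5) : e ^+ r * f = 0 -> f = 0.
Proof.
by move/eqP; rewrite mulf_eq0 expf_eq0 (negPf eulerF_neq0) andbF => /eqP.
Qed.

(** In this section [d] is the reduction modulo [5] of the generating series. *)
Section Mod5.
Variables (k : nat) (d : fps F5).
Hypothesis hd : d * e ^+ (3 * k + 1) = D2 e ^+ k.

Lemma sect4_quotient5r r : k = (5 * r)%N -> U 4 d = 0.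
Proof.
move=> kr; apply: (@eulerF_mul_eq0 (3 * r + 1)); rewrite -sectVM //.
have -> : V (e ^+ (3 * r + 1)) * d = V (D2 e ^+ r) * e ^+ 4.
  rewrite dil5_eulerF2X -kr -hd dil5_eulerFX -mulrA -exprD mulrC.
  by congr (_ * _ ^+ _); lia.
by rewrite (@sectVM _ 4 _ _ isT) sect4_eulerF4 mulr0.
Qed.

Lemma sect1_quotient5r3 r : k = (5 * r + 3)%N -> U 1 d = 0.
Proof.
move=> kr; apply: (@eulerF_mul_eq0 (3 * r + 2)); rewrite -sectVM //.
have -> : V (e ^+ (3 * r + 2)) * d = V (D2 e ^+ r) * D2 e ^+ 3.
  rewrite dil5_eulerF2X -exprD -kr -hd dil5_eulerFX mulrC; congr (_ * _ ^+ _); lia.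
by rewrite (@sectVM _ 1 _ _ isT) sect1_eulerF2_3 mulr0.
Qed.

Lemma sect43_quotient1 : k = 1%N -> U 4 (U 3 d) = 0.
Proof.
move=> k1; have {k1} hd1 : d * e ^+ 4 = D2 e by move: hd; rewrite k1 expr1.
apply: (@eulerF_mul_eq0 1).
have -> : e ^+ 1 * U 4 (U 3 d) = U 4 (U 3 (V (V (e ^+ 1)) * d)).
  by rewrite (@sectVM _ 3 _ _ isT) (@sectVM _ 4 _ _ isT).
have -> : V (V (e ^+ 1)) * d = V (e ^+ 4) * (e * D2 e).
  by rewrite -hd1 expr1 dil5_eulerFX -!fps_frobenius; ring.
rewrite (@sectVM _ 3 _ _ isT) sect3_eulerF_eulerF2.
have -> : e ^+ 4 * (V e * D2 (V e)) = V (e * D2 e) * e ^+ 4.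
  by rewrite [V (_ * _)]rmorphM (@fps_dilC _ 2 5 e isT isT) mulrC.
by rewrite (@sectVM _ 4 _ _ isT) sect4_eulerF4 mulr0.
Qed.

Lemma sect31_quotient16 : k = 16%N -> U 1 (U 3 d) = 0.
Proof.
move=> k16; have {k16} hd1 : d * e ^+ 49 = D2 e ^+ 16 by move: hd; rewrite k16.
apply: (@eulerF_mul_eq0 2).
have -> : e ^+ 2 * U 1 (U 3 d) = U 1 (U 3 (V (V (e ^+ 2)) * d)).
  by rewrite (@sectVM _ 3 _ _ isT) (@sectVM _ 1 _ _ isT).
have -> : V (V (e ^+ 2)) * d = V (D2 e ^+ 3) * (e * D2 e).
  have -> : V (D2 e ^+ 3) * (e * D2 e) = e * (D2 e ^+ 16) by rewrite dil5_eulerF2X; ring.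
  by rewrite -hd1 dil5_eulerFX -fps_frobenius; ring.
rewrite (@sectVM _ 3 _ _ isT) sect3_eulerF_eulerF2.
have -> : D2 e ^+ 3 * (V e * D2 (V e)) = V (e * D2 e) * D2 e ^+ 3.
  by rewrite [V (_ * _)]rmorphM (@fps_dilC _ 2 5 e isT isT) mulrC.
by rewrite (@sectVM _ 1 _ _ isT) sect1_eulerF2_3 mulr0.
Qed.

End Mod5.

Section Mod25.
Local Notation E := euler.
Local Notation q := (fpsq int).
Local Notation A := eulerA.
Local Notation B := eulerB.
Local Notation P := (quintic q A B (V E)).
Local Notation Y := (quint_part A B (V E)).

Lemma sect_natM (R : comNzRingType) c n (f : fps R) : U c (n%:R * f) = n%:R * U c f.
Proof. by rewrite !mulr_natl raddfMn. Qed.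

(** Cancellation modulo [5] by a series that is not divisible by [5]. *)
Lemma cancel5 (f u w : fps int) : red f != 0 -> f * u = 5 * w ->
  exists2 u', u = 5 * u' & f * u' = w.
Proof.
move=> f0 fu; have [u' def_u] : exists u', u = 5 * u'.
  apply: red_eq0; apply/eqP; have /eqP := congr1 red fu.
  by rewrite !rmorphM rmorph_nat fps5_char mul0r mulf_eq0 (negPf f0).
exists u' => //; have n5 : (5 : fps int) != 0.
  by apply/eqP => /(congr1 (fun f : fps int => f 0%N)); rewrite fps_nat0.
by apply: (mulfI n5); rewrite -fu def_u mulrCA.
Qed.

Lemma cancel25 (f u w : fps int) : red f != 0 -> f * u = 25 * w ->
  exists u', u = 25 * u'.
Proof.
have -> : (25 : fps int) = 5 * 5 by rewrite -natrM.
move=> f0; rewrite -mulrA.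
case/(cancel5 f0) => u1 -> /(cancel5 f0)[u2 -> _].
by exists u2; rewrite mulrA.
Qed.

Lemma red_eulerX n : red (E ^+ n) != 0.
Proof. by rewrite rmorphXn expf_neq0 // eulerF_neq0. Qed.

(** Raising [E(q)^5 = E(q^5)] modulo [5] to the fifth power. *)
Lemma euler25 : exists X, E ^+ 25 = V (E ^+ 5) + 25 * X.
Proof.
have [X hX] : exists X, E ^+ 5 - V E = 5 * X.
  by apply: red_eq0; rewrite rmorphB rmorphXn /= map_fps_dil fps_frobenius subrr.
have E5 : E ^+ 5 = V E + 5 * X by rewrite -hX addrC subrK.
rewrite (exprM E 5 5) [V (E ^+ 5)]rmorphXn /= E5.
exists (V E ^+ 4 * X + 10 * V E ^+ 3 * X ^+ 2 + 50 * V E ^+ 2 * X ^+ 3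
        + 125 * V E * X ^+ 4 + 125 * X ^+ 5).
by move: (V E) => v; ring.
Qed.

Lemma euler50 : exists X, E ^+ 50 = V (E ^+ 10) + 25 * X.
Proof.
have [X hX] := euler25; exists (2 * V (E ^+ 5) * X + 25 * X ^+ 2).
rewrite (exprM E 25 2) hX (exprM E 5 2) [V ((E ^+ 5) ^+ 2)]rmorphXn /=.
by move: (V (E ^+ 5)) => v; ring.
Qed.

Lemma sect1_quotient8_mod25 D : D * E ^+ 25 = D2 E ^+ 8 -> exists g, U 1 D = 25 * g.
Proof.
move=> hD; have [X hX] := euler25.
have [_ h _ _ _] := sect_dil2 (E ^+ 8).
have := congr1 (U 1) hD; rewrite hX mulrDr raddfD /= mulrC sectVM //.
rewrite -[D2 E ^+ 8]rmorphXn h (sect3_exp8 euler_dissectionP eulerAB) mulrCA sect_natM.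
pose x := q * V E ^+ 8.
have -> : - 125 * q * V E ^+ 8 = - (x *+ 125) by rewrite /x; ring.
rewrite raddfN raddfMn /= => hU.
apply: (@cancel25 (E ^+ 5) _ (- U 1 (D * X) - 5 * q * D2 x)); first exact: red_eulerX.
rewrite -[LHS](addrK (25 * U 1 (D * X))) hU.
by move: (D2 x) (U 1 _) => y z; ring.
Qed.

Lemma red_quintic : red P = e.
Proof.
by rewrite rmorph_quintic /= map_fpsq map_fps_dil -[RHS]eulerF_quintic.
Qed.

Lemma red_quintic2 : red (D2 P) = D2 e.
Proof. by rewrite map_fps_dil red_quintic. Qed.

Lemma red_sect4_quint : red (U 4 (Y * E ^+ 4)) = - 17 * V e ^+ 4 * e.
Proof.
rewrite (sect4_quint_exp4 euler_dissectionP eulerAB).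
move: red_quintic (map_fps_dil (intmul 1 : {rmorphism int -> F5}) 5 E).
move: (V E) P => v p redp redv.
rewrite !(rmorph_nat, rmorphXn, rmorphD, rmorphN, rmorphM) /= redp redv.
have -> : (55 : fps F5) = 5 * 11 by rewrite -natrM.
by rewrite fps5_char !mul0r addr0.
Qed.

Lemma red_sect4_dil2_quint :
  red (U 4 (D2 Y * E ^+ 4)) = e ^+ 4 * D2 e ^+ 9 - 2 * V e ^+ 4 * D2 e.
Proof.
rewrite (sect4_dil2_quint_exp4 euler_dissectionP) rmorph_sect4_Y2f4 /=.
by rewrite !map_fps_dil map_fpsq -sect4_eulerF_Y2e4.
Qed.

Lemma red_dil5_euler4 : red (V E ^+ 4) = V e ^+ 4.
Proof. by rewrite rmorphXn /= map_fps_dil. Qed.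

Lemma eulerF2_exp5 : D2 e ^+ 5 = V (D2 e).
Proof. exact: fps_frobenius. Qed.

Lemma euler5 : E ^+ 5 = V P + 5 * Y.
Proof. exact: (exp5_dissection euler_dissectionP). Qed.

Lemma euler2_5 : D2 E ^+ 5 = V (D2 P) + 5 * D2 Y.
Proof. by rewrite -rmorphXn euler5 rmorphD rmorphM rmorph_nat fps_dilC. Qed.

(** When [D F(q^5)] is known modulo [25], with a main term [p(q^5) w] such that
    [U_4 w] is divisible by [5], the section [U_4 D] is divisible by [5] and the
    quotient is known modulo [5]. *)
Lemma sect4_descent (D F X p p1 p2 w w1 w2 c z : fps int) : red F != 0 ->
    D * V F + 25 * X = V p * w + 5 * (V p1 * w1 + V p2 * w2) + 25 * z ->
    U 4 w = - 5 * c ->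
  exists2 G, U 4 D = 5 * G
    & red F * red G = red p1 * red (U 4 w1) + red p2 * red (U 4 w2) - red p * red c.
Proof.
move=> F0 hD hw.
have hU : F * U 4 D = 5 * (p1 * U 4 w1 + p2 * U 4 w2 - p * c + 5 * (U 4 z - U 4 X)).
  have := congr1 (U 4) hD; rewrite mulrC !raddfD /= !sect_natM !raddfD /= !sectVM // hw.
  move: (U 4 D) (U 4 X) (U 4 w1) (U 4 w2) (U 4 z) => D' X' v1 v2 z' h.
  by rewrite -[LHS](addrK (25 * X')) h; ring.
have [G -> hG] := cancel5 F0 hU; exists G => //.
rewrite -rmorphM hG rmorphD [X in _ + X]rmorphM rmorph_nat fps5_char mul0r addr0.
by rewrite rmorphB rmorphD !rmorphM.
Qed.

Lemma sect43_quotient5_mod25 D : D * E ^+ 16 = D2 E ^+ 5 -> exists g, U 3 (U 4 D) = 25 * g.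
Proof.
move=> hD; have [X hX] := euler25.
have hD25 : D * V (E ^+ 5) + 25 * (D * X)
  = V (P * D2 P) * E ^+ 4 + 5 * (V (D2 P) * (Y * E ^+ 4) + V P * (D2 Y * E ^+ 4))
    + 25 * (Y * D2 Y * E ^+ 4).
  have -> : D * V (E ^+ 5) + 25 * (D * X) = D * E ^+ 25 by rewrite hX; ring.
  have -> : D * E ^+ 25 = (D * E ^+ 16) * E ^+ 4 * E ^+ 5 by ring.
  rewrite hD euler2_5 euler5 [V (P * _)]rmorphM /=.
  by move: (V P) (V (D2 P)) Y (D2 Y) => *; ring.
have [G -> hG] := sect4_descent (red_eulerX 5) hD25 (sect4_exp4 euler_dissectionP eulerAB).
rewrite sect_natM; suff /red_eq0[g ->] : red (U 3 G) = 0 by exists g; ring.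
have {}hG : e ^+ 5 * red G = e ^+ 5 * D2 e ^+ 9.
  move: hG; rewrite red_sect4_quint red_sect4_dil2_quint red_quintic2.
  rewrite [red (P * _)]rmorphM /= red_quintic red_quintic2 red_dil5_euler4.
  rewrite rmorphXn /= => ->; move: e (D2 e) (V e) => x y c.
  set l := LHS; have -> : l = x ^+ 5 * y ^+ 9 - 5 * (4 * x * y * c ^+ 4) by rewrite /l; ring.
  by rewrite fps5_char mul0r subr0.
have e5 : e ^+ 5 != 0 by rewrite expf_neq0 // eulerF_neq0.
rewrite map_fps_sect (mulfI e5 hG) (exprD _ 5 4) eulerF2_exp5 (@sectVM _ 3 _ _ isT).
by rewrite sect3_eulerF2_4 mulr0.
Qed.

(** The expansion of [f2^10 f^19] modulo [25], from those of [f^5] and [f2^5]. *)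
Lemma expand_exp19 (f f2 p p2 y y2 : fps int) :
    f ^+ 5 = V p + 5 * y -> f2 ^+ 5 = V p2 + 5 * y2 ->
  exists z, f2 ^+ 10 * f ^+ 19 = V (p ^+ 3 * p2 ^+ 2) * f ^+ 4
    + 5 * (V (3%:R * (p ^+ 2 * p2 ^+ 2)) * (y * f ^+ 4)
           + V (2%:R * (p ^+ 3 * p2)) * (y2 * f ^+ 4)) + 25 * z.
Proof.
move=> f5 f25; pose v := V p; pose v2 := V p2.
exists (f ^+ 4 * (6 * v ^+ 2 * y * v2 * y2 + v ^+ 3 * y2 ^+ 2 + 15 * v ^+ 2 * y * y2 ^+ 2
  + (3 * v * y ^+ 2 + 5 * y ^+ 3) * (v2 + 5 * y2) ^+ 2)).
have -> : f2 ^+ 10 * f ^+ 19 = (f2 ^+ 5) ^+ 2 * (f ^+ 4 * (f ^+ 5) ^+ 3) by ring.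
have Vn n g : V (n%:R * g) = n%:R * V g :> fps int by rewrite !mulr_natl raddfMn.
have VX n g : V (g ^+ n) = V g ^+ n :> fps int by rewrite rmorphXn.
have VM g h : V (g * h) = V g * V h :> fps int by rewrite rmorphM.
rewrite f5 f25 !Vn (VM (p ^+ 3) (p2 ^+ 2)) (VM (p ^+ 2) (p2 ^+ 2)) (VM (p ^+ 3) p2) !VX.
rewrite -/v -/v2.
by move: v v2 => v v2; ring.
Qed.

(** Here [G = - E^23 E2^2 + 2 E^7 E2^10] divided by [E^10], with [E2 = E(q^2)]; the
    contributions of the two terms to [U_2] cancel modulo [5]. *)
Lemma sect42_quotient10_mod25 D : D * E ^+ 31 = D2 E ^+ 10 -> exists g, U 2 (U 4 D) = 25 * g.
Proof.
move=> hD; have [X hX] := euler50.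
have [Z hZ] := expand_exp19 euler5 euler2_5.
have hD25 : D * V (E ^+ 10) + 25 * (D * X) = D2 E ^+ 10 * E ^+ 19.
  have -> : D * V (E ^+ 10) + 25 * (D * X) = D * E ^+ 50 by rewrite hX; ring.
  by rewrite -hD; ring.
rewrite hZ in hD25.
have [G -> hG] := sect4_descent (red_eulerX 10) hD25 (sect4_exp4 euler_dissectionP eulerAB).
rewrite sect_natM; suff /red_eq0[g ->] : red (U 2 G) = 0 by exists g; ring.
have {}hG : V (e ^+ 2) * red G
    = V (e ^+ 4) * (- (e ^+ 3 * D2 e ^+ 2)) + V (e * D2 e ^+ 2) * (2%:R * e ^+ 2).
  have -> : V (e * D2 e ^+ 2) = e ^+ 5 * D2 e ^+ 10 by rewrite -fps_frobenius; ring.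
  rewrite !dil5_eulerFX; move: hG.
  rewrite red_sect4_quint red_sect4_dil2_quint red_dil5_euler4 rmorphXn /=.
  have [rP rP2] := (red_quintic, red_quintic2); move: P rP rP2 => p rP rP2.
  rewrite !(rmorph_nat, rmorphXn, rmorphM) /= rP rP2 -fps_frobenius => ->.
  move: e (D2 e) => x y; set l := LHS; set r := RHS.
  have -> : l = r - 5 * (11 * x ^+ 23 * y ^+ 2) by rewrite /l /r; ring.
  by rewrite fps5_char mul0r subr0.
apply: (@eulerF_mul_eq0 2); rewrite map_fps_sect -(@sectVM _ 2 _ _ isT) hG.
rewrite raddfD /= (@sectVM _ 2 _ _ isT) (@sectVM _ 2 _ _ isT) raddfN /= sect_natM.
rewrite (sect2_exp2 eulerF_dissection eulerF_AB) (sect2_exp3_dil2 eulerF_dissection).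
rewrite sect2_eulerF_e3e2 -fps_frobenius.
move: e (D2 e) => x y.
set l := LHS; have -> : l = 5 * (- x ^+ 11 * y ^+ 2) by rewrite /l; ring.
by rewrite fps5_char mul0r.
Qed.
End Mod25.

End Mod5Series.

(** * From analytic to formal identities *)

Section RealLimits.
Local Open Scope classical_set_scope.
Variable R : realType.

Lemma cvgn_dist_le (u : nat -> R) (l c K : R) m :
  u @ \oo --> l -> (forall n, (m <= n)%N -> `|u n - c| <= K) -> `|l - c| <= K.
Proof.
move=> ul uc; apply/ler_addgt0Pr => eps eps0.
have /cvgrPdist_lt /(_ _ eps0) [n0 _ hn0] := ul.
have := hn0 (maxn m n0) (leq_maxr _ _); have := uc (maxn m n0) (leq_maxl _ _).
set x := u _ => h1 h2; apply: le_trans (ler_distD x _ _) _.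
by rewrite addrC lerD // ltW.
Qed.

(** Partial products of [(r; r)_oo]. *)
Definition poch (r : R) n := \prod_(0 <= j < n) (1 - r * r ^+ j).

Lemma pochS r n : poch r n.+1 = poch r n * (1 - r ^+ n.+1).
Proof. by rewrite /poch big_nat_recr //= exprS. Qed.

Section Small.
Variable r : R.
Hypotheses (r0 : 0 < r) (r4 : 4 * r <= 1).

Let rX n : 0 <= r ^+ n.+1 <= r.
Proof.
have r1 : r <= 1 by move: r0 r4; lra.
have x1 : r ^+ n <= 1 by rewrite exprn_ile1 // ltW.
by apply/andP; split; [exact: exprn_ge0 (ltW r0) | rewrite exprS ler_piMr // ltW].
Qed.

Lemma poch_bounds n : 0 <= poch r n <= 1.
Proof.
elim: n => [|n /andP[h0 h1]]; first by rewrite /poch big_geq // ler01 lexx.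
have /andP[x0 x1] := rX n; rewrite pochS mulr_ge0 ?mulr_ile1 //; move: r0 r4 x0 x1; lra.
Qed.

Lemma poch_noninc : {homo poch r : n m / (n <= m)%N >-> m <= n}.
Proof.
apply/nonincreasing_seqP => n; rewrite pochS.
by have /andP[h0 _] := poch_bounds n; have /andP[x0 _] := rX n; rewrite ler_piMr //; lra.
Qed.

(** The tail is bounded by a geometric series; the last term of the left-hand side
    makes the induction go through. *)
Lemma poch_tail N m : (N <= m)%N ->
  poch r N - 2 * r ^+ N.+1 + 2 * r ^+ m.+1 <= poch r m.
Proof.
move=> /subnK <-; elim: (m - N)%N => [|k IH]; first by rewrite add0n; lra.
rewrite addSn pochS [r ^+ (k + N).+2]exprS.
have /andP[h0 h1] := poch_bounds (k + N); have /andP[x0 _] := rX (k + N).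
move: IH h0 h1 x0 r0 r4; set p := poch r _; set x := r ^+ _; set y := r ^+ _.
by move=> IH h0 h1 x0 r0' r4'; nra.
Qed.

(** The infinite product [(r; r)_oo]. *)
Definition pochoo := limn (poch r).

Lemma poch_cvg : poch r @ \oo --> pochoo.
Proof.
apply: nonincreasing_is_cvgn; first exact: poch_noninc.
by exists 0 => _ [n _ <-]; have /andP[] := poch_bounds n.
Qed.

Lemma poch_dist N : `|pochoo - poch r N| <= 2 * r ^+ N.+1.
Proof.
apply: (@cvgn_dist_le (poch r) _ _ _ N poch_cvg) => n le_Nn.
have := poch_tail le_Nn; have := poch_noninc le_Nn; have /andP[x0 _] := rX n.
by move=> h1 h2; rewrite ler_norml; apply/andP; split; lra.
Qed.

Lemma pochoo_bounds : 0 < pochoo <= 1.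
Proof.
have := poch_dist 0; rewrite ler_norml expr1 /poch big_geq // => /andP[h _].
have -> /= : 0 < pochoo by move: h r0 r4; lra.
apply: limr_le; first by apply/cvg_ex; exists pochoo; exact: poch_cvg.
by near=> n; have /andP[] := poch_bounds n.
Unshelve. all: by end_near.
Qed.

End Small.

(** Partial sums of a real power series with integer coefficients. *)
Definition power_psum (d : nat -> int) (r : R) n := \sum_(0 <= i < n) (d i)%:~R * r ^+ i.

(** If the series converges at [1/4], its coefficients are [O(4^n)], and the error of
    the partial sum of order [N] is [O(r^(N+1))] for [r <= 1/8]. *)
Lemma power_psum_dist (d : nat -> int) N : cvgn (power_psum d (1 / 4)) ->
  exists2 K, 0 <= K & forall r v, 0 < r -> 8 * r <= 1 -> power_psum d r @ \oo --> v ->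
    `|v - power_psum d r N.+1| <= K * r ^+ N.+1.
Proof.
move=> cv4; have [M M0 dM] : exists2 M, 0 <= M & forall n, `|(d n)%:~R : R| <= M * 4 ^+ n.
  have /cvg_series_cvg_0 cv0 := cv4.
  have /cvg_seq_bounded [M0 [_ hM]] : cvgn (fun n => (d n)%:~R * (1 / 4) ^+ n : R).
    by apply/cvg_ex; exists 0.
  exists (`|M0| + 1); first by rewrite addr_ge0.
  move=> n; have M1 : M0 < `|M0| + 1 by rewrite (le_lt_trans (ler_norm _)) // ltrDl.
  have : `|(d n)%:~R * (1 / 4) ^+ n : R| <= `|M0| + 1 := hM _ M1 n I.
  rewrite normrM [`|_ ^+ n|]ger0_norm ?exprn_ge0 // mul1r exprVn.
  by rewrite ler_pdivrMr ?exprn_gt0.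
exists (2 * M * 4 ^+ N.+1) => [|r v r0 r8 vP]; first by rewrite !mulr_ge0 ?exprn_ge0.
apply: (@cvgn_dist_le _ _ _ _ N.+1 vP) => n le_Nn.
rewrite -mulrA -exprMn; set x := 4 * r.
have x0 : 0 <= x by rewrite /x; lra.
suff : `|power_psum d r n - power_psum d r N.+1| <= 2 * M * x ^+ N.+1 - 2 * M * x ^+ n.
  by move/le_trans; apply; rewrite gerBl !mulr_ge0 ?exprn_ge0.
move: le_Nn => /subnK <-; elim: (n - N.+1)%N => [|k IH].
  by rewrite add0n !subrr normr0.
have -> : power_psum d r (k.+1 + N.+1)
    = power_psum d r (k + N.+1) + (d (k + N.+1)%N)%:~R * r ^+ (k + N.+1).
  by rewrite /power_psum addSn big_nat_recr.
rewrite addSn addrAC.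
apply: le_trans (ler_normD _ _) _.
have hd : `|(d (k + N.+1)%N)%:~R * r ^+ (k + N.+1)| <= M * x ^+ (k + N.+1).
  have rX : 0 <= r ^+ (k + N.+1) by exact: exprn_ge0 (ltW r0).
  by rewrite normrM [`|r ^+ _|]ger0_norm // /x exprMn mulrA ler_wpM2r.
apply: le_trans (lerD IH hd) _.
have : 0 <= M * x ^+ (k + N.+1) by rewrite mulr_ge0 ?exprn_ge0.
rewrite [x ^+ (k + N.+1).+1]exprS; have : x <= 1 / 2 by rewrite /x; lra.
by move: (x ^+ (k + N.+1)) => y hx hy; nra.
Qed.

(** [f - g = O(r^(N+1))] for [0 < r <= 1/8]. *)
Definition small_eq N (f g : R -> R) :=
  exists2 K, 0 <= K & forall r, 0 < r -> 8 * r <= 1 -> `|f r - g r| <= K * r ^+ N.+1.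

(** [f = O(1)] for [0 < r <= 1/8]. *)
Definition small_bounded (f : R -> R) :=
  exists2 K, 0 <= K & forall r, 0 < r -> 8 * r <= 1 -> `|f r| <= K.

Lemma small_eqM N f g f' g' : small_bounded f -> small_bounded g' ->
  small_eq N f g -> small_eq N f' g' -> small_eq N (f \* f') (g \* g').
Proof.
move=> [F F0 hF] [G G0 hG] [K K0 hK] [L L0 hL].
exists (F * L + K * G) => [|r r0 r8]; first by rewrite addr_ge0 ?mulr_ge0.
have -> : (f \* f') r - (g \* g') r = f r * (f' r - g' r) + (f r - g r) * g' r.
  by rewrite /=; ring.
apply: le_trans (ler_normD _ _) _; rewrite !normrM mulrDl.
apply: lerD; last by apply: le_trans (ler_pM _ _ (hK r r0 r8) (hG r r0 r8)) _;
  rewrite // mulrAC.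
by apply: le_trans (ler_pM _ _ (hF r r0 r8) (hL r r0 r8)) _; rewrite // mulrA.
Qed.

Lemma small_eqX N f g k : (forall r, 0 < r -> 8 * r <= 1 -> `|f r| <= 1) ->
    (forall r, 0 < r -> 8 * r <= 1 -> `|g r| <= 1) ->
  small_eq N f g -> small_eq N (fun r => f r ^+ k) (fun r => g r ^+ k).
Proof.
move=> f1 g1 fg; elim: k => [|k IH].
  by exists 0 => // r _ _; rewrite !expr0 subrr normr0 mul0r.
have gk : small_bounded (fun r => g r ^+ k).
  by exists 1 => // r r0 r8; rewrite normrX exprn_ile1 ?g1.
have f1' : small_bounded f by exists 1.
have [K K0 hK] := small_eqM f1' gk fg IH.
by exists K => // r r0 r8; have := hK r r0 r8; rewrite !exprS.
Qed.

Lemma poly_small_bounded (p : {poly R}) : small_bounded (horner p).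
Proof.
elim/poly_ind: p => [|p c [K K0 hK]].
  by exists 0 => // r _ _; rewrite horner0 normr0.
exists (K + `|c|) => [|r r0 r8]; first by rewrite addr_ge0.
rewrite hornerMXaddC; apply: le_trans (ler_normD _ _) _; rewrite lerD // normrM.
have r1 : `|r| <= 1 by rewrite ger0_norm ?ltW //; lra.
by apply: le_trans (ler_pM _ _ (hK r r0 r8) r1) _; rewrite // mulr1.
Qed.

(** A polynomial that is [O(r^n)] at [0] has no term of degree less than [n]. *)
Lemma poly_small_coef n (p : {poly R}) K :
    (forall r, 0 < r -> 8 * r <= 1 -> `|p.[r]| <= K * r ^+ n) ->
  forall i, (i < n)%N -> p`_i = 0.
Proof.
elim: n p => // n IH p; elim/poly_ind: p => [|p c _] hp i lt_in; first by rewrite coef0.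
have [L L0 hL] := poly_small_bounded p.
have K0 : 0 <= K.
  have h0 : 0 < 1 / 8 :> R by lra.
  have h1 : 8 * (1 / 8) <= 1 :> R by lra.
  have := le_trans (normr_ge0 _) (hp _ h0 h1).
  by rewrite pmulr_lge0 // exprn_gt0.
have c0 : c = 0.
  apply/eqP; rewrite -normr_le0; apply/ler_addgt0Pr => eps eps0; rewrite add0r.
  pose r := Num.min (1 / 8) (eps / (K + L + 1)).
  have KL : 0 < K + L + 1 by lra.
  have r0 : 0 < r by rewrite lt_min; apply/andP; split; [lra | exact: divr_gt0].
  have r8 : 8 * r <= 1 by have : r <= 1 / 8 by [rewrite ge_min lexx]; lra.
  have re : r * (K + L + 1) <= eps by rewrite -ler_pdivlMr // ge_min lexx orbT.
  have rn : r ^+ n <= 1 by rewrite exprn_ile1 ?ltW //; lra.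
  have := hp r r0 r8; rewrite hornerMXaddC exprS => h.
  have -> : c = (p.[r] * r + c) - p.[r] * r by ring.
  apply: le_trans (ler_normB _ _) _; apply: le_trans (lerD h (lexx _)) _.
  rewrite normrM (ger0_norm (ltW r0)); apply: le_trans _ re.
  have h1 : K * (r * r ^+ n) <= K * r by rewrite ler_wpM2l // ler_piMr // ltW.
  have h2 : `|p.[r]| * r <= L * r by rewrite ler_wpM2r ?hL // ltW.
  by move: h1 h2 r0; lra.
move: hp; rewrite c0 addr0 => hp; rewrite coefMX; case: i lt_in => // i lt_in /=.
apply: (IH p) => // r r0 r8; have := hp r r0 r8.
by rewrite hornerMX normrM (ger0_norm (ltW r0)) exprSr mulrA ler_pM2r.
Qed.

Local Notation toR := (map_poly (intmul 1 : {rmorphism int -> R})).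

Lemma horner_euler_poly N r : (toR (euler_poly N)).[r] = poch r N.
Proof.
rewrite /euler_poly /euler_range /poch big_add1 /= rmorph_prod horner_prod.
apply: eq_bigr => j _; rewrite rmorphB rmorph1 rmorphXn /= map_polyX.
by rewrite hornerD hornerN hornerXn hornerC exprS.
Qed.

Lemma horner_euler_poly2 N r : (toR (euler_poly N \Po 'X^2)).[r] = poch (r ^+ 2) N.
Proof. by rewrite map_comp_poly map_polyXn horner_comp hornerXn horner_euler_poly. Qed.

Lemma horner_trunc (d : nat -> int) N r :
  (toR (fps_trunc N (Fps d))).[r] = power_psum d r N.
Proof.
rewrite (@horner_coef_wide _ N) ?(leq_trans (size_poly _ _)) ?size_poly //.
rewrite /power_psum big_mkord; apply: eq_bigr => i _.
by rewrite coef_map coef_poly ltn_ord.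
Qed.

(** From the convergent identity to the formal one. At order [N], replace the series
    and the products by their truncations [D] and [P]: the polynomial
    [D P^m - P(q^2)^k] is [O(r^(N+1))]. *)
Lemma fps_of_limits (d : nat -> int) k m :
    (forall r, 0 < r -> 4 * r <= 1 ->
      power_psum d r @ \oo --> pochoo (r ^+ 2) ^+ k / pochoo r ^+ m) ->
  (Fps d : fps int) * euler ^+ m = fps_dil 2 euler ^+ k.
Proof.
move=> hd; apply: fpsP => N.
pose D := fps_trunc N.+1 (Fps d); pose P := euler_poly N.
pose T := D * P ^+ m - (P \Po 'X^2) ^+ k.
have r4 r : 8 * r <= 1 -> 0 < r -> 4 * r <= 1 :> R by lra.
have r24 r : 8 * r <= 1 -> 0 < r -> 4 * r ^+ 2 <= 1 :> R by nra.
suff /eqP : T`_N = 0.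
  rewrite coefB subr_eq0 => /eqP TN.
  rewrite (@fpsM_coef _ _ _ D (P ^+ m)) => [|i le_iN|i le_iN].
  - rewrite TN; apply/esym; apply: fpsX_coef => i le_iN.
    rewrite fps_dilE coef_comp_poly_Xn //; case: ifP => // _.
    by rewrite euler_poly_coef // (leq_trans (leq_div _ _) le_iN).
  - by rewrite coef_trunc.
  by apply: fpsX_coef => j le_ji; rewrite euler_poly_coef // (leq_trans le_ji).
pose v r := pochoo (r ^+ 2) ^+ k / pochoo r ^+ m.
have nb r : 0 < r -> 8 * r <= 1 -> `|poch r N| <= 1 /\ `|pochoo r| <= 1.
  move=> r0 r8; have /andP[h0 h1] := poch_bounds r0 (r4 _ r8 r0) N.
  have /andP[h2 h3] := pochoo_bounds r0 (r4 _ r8 r0).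
  by rewrite !ger0_norm // ltW.
have nb2 r : 0 < r -> 8 * r <= 1 -> `|poch (r ^+ 2) N| <= 1 /\ `|pochoo (r ^+ 2)| <= 1.
  move=> r0 r8; have r20 : 0 < r ^+ 2 by rewrite exprn_gt0.
  have /andP[h0 h1] := poch_bounds r20 (r24 _ r8 r0) N.
  have /andP[h2 h3] := pochoo_bounds r20 (r24 _ r8 r0).
  by rewrite !ger0_norm // ltW.
have e1 : small_eq N (fun r => poch r N ^+ m) (fun r => pochoo r ^+ m).
  apply: small_eqX => [r /nb h /h[] //|r /nb h /h[] //|].
  by exists 2 => // r r0 r8; rewrite distrC poch_dist // r4.
have e2 : small_eq N (fun r => poch (r ^+ 2) N ^+ k) (fun r => pochoo (r ^+ 2) ^+ k).
  apply: small_eqX => [r /nb2 h /h[] //|r /nb2 h /h[] //|].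
  exists 2 => // r r0 r8; rewrite distrC.
  have r20 : 0 < r ^+ 2 by rewrite exprn_gt0.
  apply: le_trans (poch_dist r20 (r24 _ r8 r0) N) _; rewrite ler_pM2l // exprAC expr2.
  have x0 : 0 <= r ^+ N.+1 by exact: exprn_ge0 (ltW r0).
  by rewrite ler_piMr // exprn_ile1 ?(ltW r0) //; lra.
have e0 : small_eq N (fun r => power_psum d r N.+1) v.
  have cv : cvgn (power_psum d (1 / 4)) by apply/cvg_ex; eexists; apply: hd; lra.
  have [K K0 hK] := power_psum_dist N cv; exists K => // r r0 r8.
  by rewrite distrC; apply: hK => //; apply: hd => //; exact: r4.
have [K1 K10 h1] : small_eq N ((fun r => power_psum d r N.+1) \* (fun r => poch r N ^+ m))
    (v \* (fun r => pochoo r ^+ m)).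
  apply: small_eqM => //.
    have [K K0 hK] := poly_small_bounded (toR D); exists K => // r r0 r8.
    by rewrite -horner_trunc hK.
  by exists 1 => // r r0 r8; rewrite normrX exprn_ile1 //; have [] := nb r r0 r8.
have [K2 K20 h2] := e2.
have : (toR T)`_N = 0.
  apply: (@poly_small_coef N.+1 _ (K1 + K2)) => // r r0 r8.
  rewrite rmorphB rmorphM !rmorphXn /= hornerD hornerN hornerM !horner_exp.
  rewrite horner_trunc horner_euler_poly horner_euler_poly2 mulrDl.
  have := h1 r r0 r8; have := h2 r r0 r8.
  have -> : (v \* (fun r => pochoo r ^+ m)) r = pochoo (r ^+ 2) ^+ k.
    rewrite /v /= divfK // expf_neq0 //.
    by have /andP[/lt0r_neq0] := pochoo_bounds r0 (r4 _ r8 r0).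
  move=> h2' h1'; apply: le_trans (ler_distD (pochoo (r ^+ 2) ^+ k) _ _) _.
  by rewrite lerD // distrC.
by rewrite coef_map /= => /eqP; rewrite intr_eq0 => /eqP.
Qed.

End RealLimits.

Section Complex.
Local Open Scope classical_set_scope.
Variable R : realType.
Local Notation C := (R[i]%C : numFieldType).

Lemma norm_real_complex (x : R) : `|x%:C%C| = `|x|%:C%C.
Proof. by rewrite normc_def /= expr0n addr0 sqrtr_sqr. Qed.

(** A sequence of real numbers has the same real limits in the complex numbers: a
    positive complex number is real. *)
Lemma cvg_real_complex (u : nat -> R) (l : R) :
  ((fun n => (u n)%:C%C : C) @ \oo --> (l%:C%C : C)) <-> (u @ \oo --> l).
Proof.
split => /cvgrPdist_lt h; apply/cvgrPdist_lt => eps eps0.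
  have eps0' : 0 < eps%:C%C :> R[i] by rewrite ltcR.
  have [N _ hN] := h _ eps0'; exists N => // n /hN.
  by rewrite /= -rmorphB norm_real_complex ltcR.
have [Im0 Re0] : complex.Im eps = 0 /\ 0 < complex.Re eps.
  by move: eps0; rewrite ltcE /= => /andP[/eqP].
have [N _ hN] := h _ Re0; exists N => // n /hN.
rewrite /= -rmorphB norm_real_complex -(ltcR _ (complex.Re eps)) => /lt_le_trans; apply.
by case: eps Im0 {eps0 Re0 h hN} => a b /= ->.
Qed.

Lemma qpochhammer_real (r : R) : 0 < r -> 4 * r <= 1 ->
  qpochhammer (r%:C%C : C) (r%:C%C : C) = (pochoo r)%:C%C.
Proof.
move=> r0 r4; apply: cvg_lim; first exact: norm_hausdorff.
have /cvg_real_complex := poch_cvg r0 r4.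
by under eq_fun do rewrite /poch rmorph_prod; under eq_fun do under eq_bigr do
  rewrite rmorphB rmorph1 rmorphM rmorphXn.
Qed.

(** The formal identity [D_k E^(3k+1) = E(q^2)^k]. *)
Lemma is_dk_fps k d : is_dk R[i]%C k d ->
  (Fps d : fps int) * euler ^+ (3 * k + 1) = fps_dil 2 euler ^+ k.
Proof.
move=> hd; apply: (@fps_of_limits R) => r r0 r4.
have r1 : `|r%:C%C| < 1 :> R[i].
  by rewrite norm_real_complex (ltcR _ 1) ger0_norm ?ltW //; lra.
have r20 : 0 < r ^+ 2 by rewrite exprn_gt0.
have r24 : 4 * r ^+ 2 <= 1 by nra.
have E1 := qpochhammer_real r0 r4.
have E2 : qpochhammer (r%:C%C ^+ 2 : C) (r%:C%C ^+ 2 : C) = (pochoo (r ^+ 2))%:C%C.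
  by rewrite -(qpochhammer_real r20 r24) rmorphXn.
have Es : series (fun n => (d n)%:~R * r%:C%C ^+ n : C) = (fun n => (power_psum d r n)%:C%C).
  apply/funext => n; rewrite /series /power_psum /= rmorph_sum; apply: eq_bigr => j _.
  by rewrite rmorphM rmorphXn rmorph_int.
have Ev : (pochoo (r ^+ 2) ^+ k / pochoo r ^+ (3 * k + 1))%:C%C
    = (pochoo (r ^+ 2))%:C%C ^+ k / (pochoo r)%:C%C ^+ (3 * k + 1) :> C.
  by rewrite rmorphM fmorphV !rmorphXn.
apply/cvg_real_complex; have := hd _ r1; rewrite Es E1 E2 -Ev; exact.
Qed.

End Complex.

(** * The congruences *)

Section Coefficients.
Local Notation U := fps_sect.
Local Notation F5 := 'F_5.
Local Notation e := eulerF.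
Local Notation red := (map_fps (intmul 1 : {rmorphism int -> F5})).

Lemma fps_mod_coef m (f g : fps int) n : f = m%:R * g -> (f n = 0 %[mod m])%Z.
Proof.
by move=> ->; rewrite mulr_natl fpsMnE -mulr_natr natz modzMl mod0z.
Qed.

Lemma red_sect_mod5 i j (f : fps int) n : U i (U j (red f)) = 0 ->
  (f (5 * (5 * n + i) + j)%N = 0 %[mod 5])%Z.
Proof.
rewrite -!map_fps_sect => /red_eq0[g hg].
exact: (@fps_mod_coef 5 _ _ n hg).
Qed.

Variables (R : realType) (d : nat -> nat -> int).
Hypothesis hd : forall k : nat, is_dk R[i]%C k (d k).

Let D k : fps int := Fps (d k).
Let redD k : red (D k) * e ^+ (3 * k + 1) = fps_dil 2 e ^+ k.
Proof.
have := congr1 red (is_dk_fps (@hd k)).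
by rewrite rmorphM !rmorphXn /= map_fps_dil.
Qed.

(** The index [25 n + l] with [l = 5 i + j] is reached by taking the section [j] and
    then the section [i]. *)
Lemma dk_mod5 i j k n : U i (U j (red (D k))) = 0 ->
  (d k (25 * n + (5 * i + j)) = 0 %[mod 5])%Z.
Proof.
move=> /(red_sect_mod5 n); rewrite (_ : 25 * n + _ = 5 * (5 * n + i) + j)%N //; lia.
Qed.

Lemma dk_mod25 i j k n : (exists g, U i (U j (D k)) = 25 * g) ->
  (d k (25 * n + (5 * i + j)) = 0 %[mod 25])%Z.
Proof.
move=> [g /(@fps_mod_coef 25 _ _ n)].
rewrite !fps_sectE (_ : 25 * n + _ = 5 * (5 * n + i) + j)%N //; lia.
Qed.

Lemma dk_5r_mod5 r i n : (d (5 * r) (25 * n + (5 * i + 4)) = 0 %[mod 5])%Z.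
Proof. by apply: dk_mod5; rewrite (sect4_quotient5r (redD _) (erefl _)) raddf0. Qed.

Lemma dk_5r3_mod5 r i n : (d (5 * r + 3) (25 * n + (5 * i + 1)) = 0 %[mod 5])%Z.
Proof. by apply: dk_mod5; rewrite (sect1_quotient5r3 (redD _) (erefl _)) raddf0. Qed.

Lemma dk_1_mod5 n : (d 1 (25 * n + 23) = 0 %[mod 5])%Z.
Proof. exact: (dk_mod5 n (sect43_quotient1 (redD 1) (erefl _))). Qed.

Lemma dk_16_mod5 n : (d 16 (25 * n + 8) = 0 %[mod 5])%Z.
Proof. exact: (dk_mod5 n (sect31_quotient16 (redD 16) (erefl _))). Qed.

Lemma dk_5_mod25 n : (d 5 (25 * n + 19) = 0 %[mod 25])%Z.
Proof. exact: (@dk_mod25 3 4 _ n (sect43_quotient5_mod25 (is_dk_fps (@hd 5)))). Qed.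

Lemma dk_8_mod25 n : (d 8 (25 * n + 16) = 0 %[mod 25])%Z.
Proof.
apply: (@dk_mod25 3 1 _ n); have [g ->] := sect1_quotient8_mod25 (is_dk_fps (@hd 8)).
by exists (U 3 g); rewrite sect_natM.
Qed.

Lemma dk_10_mod25 n : (d 10 (25 * n + 14) = 0 %[mod 25])%Z.
Proof. exact: (@dk_mod25 2 4 _ n (sect42_quotient10_mod25 (is_dk_fps (@hd 10)))). Qed.

End Coefficients.

Unset Implicit Arguments.
Local Close Scope ring_scope.

Theorem theorem1p5 (R : realType) (d : nat -> nat -> int)
    (hd : forall k : nat, is_dk R[i]%C k (d k)) :
  (forall k l : nat,
     k \in [:: 1; 3; 5; 8; 10; 13; 15; 16; 18; 20; 23] -> k + l = 24 ->
     forall n : nat, (d k (25 * n + l)%N = 0 %[mod 5])%Z) /\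
  (forall k l : nat,
     k \in [:: 5; 8; 10] -> k + l = 24 ->
     forall n : nat, (d k (25 * n + l)%N = 0 %[mod 25])%Z).
Proof.
split=> k l; rewrite !inE => hk kl n; have -> : l = 24 - k by rewrite -kl addKn.
  repeat (case/orP: hk => hk); move/eqP: hk => ->.
  - exact: dk_1_mod5 hd n.
  - exact: dk_5r3_mod5 hd 0 4 n.
  - exact: dk_5r_mod5 hd 1 3 n.
  - exact: dk_5r3_mod5 hd 1 3 n.
  - exact: dk_5r_mod5 hd 2 2 n.
  - exact: dk_5r3_mod5 hd 2 2 n.
  - exact: dk_5r_mod5 hd 3 1 n.
  - exact: dk_16_mod5 hd n.
  - exact: dk_5r3_mod5 hd 3 1 n.
  - exact: dk_5r_mod5 hd 4 0 n.
  - exact: dk_5r3_mod5 hd 4 0 n.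
case/or3P: hk => /eqP->.
- exact: dk_5_mod25 hd n.
- exact: dk_8_mod25 hd n.
- exact: dk_10_mod25 hd n.
Qed.
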